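(* Let $p$ be a prime and let $F(X,Y)\in\mathbb{F}_p[X,Y]$ be an absolutely irreducible polynomial of total degree $d\ge 2$, with $\delta=\delta(F)$. Then for any positive integer $$H\le p^{1/\left((d-1/2)\delta+1/2\right)},$$ uniformly over arbitrary intervals $\mathcal{I}=[K,K+H]$ and $\mathcal{J}=[L,L+H]$, we have $$N_F(\mathcal{I},\mathcal{J})\le H^{1/d+o(1)}.$$
   Context: $\mathbb{F}_p$ is the finite field of $p$ elements, represented by the integers $\{0,1,\ldots,p-1\}$. An interval $[K,K+H]$ (with $K$ an integer) is viewed as a subset of $\mathbb{F}_p$, namely the set of residue classes modulo $p$ of the integers $K,K+1,\ldots,K+H$. For sets $\mathcal{A},\mathcal{B}\subset\mathbb{F}_p$, $$N_F(\mathcal{A},\mathcal{B})=\#\{(a,b)\in\mathcal{A}\times\mathcal{B} : F(a,b)=0\}.$$ For $F(X,Y)=\sum_{(i,j)\in\mathcal{F}}F_{i,j}X^iY^j$, where $F_{i,j}\neq 0$ if and only if $(i,j)\in\mathcal{F}$, the quantity $\delta(F)$ is the number of distinct monomial divisors of the monomial terms of $F$: $$\delta(F)=\#\{(k,\ell) : 0\le k\le i,\ 0\le \ell\le j \text{ for some } (i,j)\in\mathcal{F}\}.$$ The term $o(1)$ denotes a quantity that tends to $0$ as $H\to\infty$ for fixed $d$, uniformly in $p$, in $F$ of degree $d$, and in the intervals $\mathcal{I},\mathcal{J}$ (subject to the stated restriction on $H$).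
   Formalization: The bound is stated for every integer H ≥ 2 rather than every positive integer H: at H = 1 the right side equals 1 whatever o(1) is, and the claim fails (F = Y − X², I = J = [0,1] has at least two zeros). *)

(* Defs.v *)
From HB Require Import structures.
From mathcomp Require Import all_boot all_order all_algebra closed_field.

Set Implicit Arguments.
Unset Strict Implicit.
Unset Printing Implicit Defensive.

Import GRing.Theory.
Local Open Scope ring_scope.

(* Bivariate polynomials follow the convention of polyXY: for
   F : {poly {poly R}} the outer variable is X and the inner one is Y, so that
   F`_i`_j is the coefficient of X^i Y^j and F.[x, y] is the value F(x, y). *)

Definition irreducible_elt (A : idomainType) (a : A) : Prop :=
  [/\ a != 0, a \isn't a GRing.unit
    & forall b c : A, a = b * c -> b \is a GRing.unit \/ c \is a GRing.unit].

Definition alg_closure (k : countFieldType) : countClosedFieldType :=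
  projT1 (countable_algebraic_closure k).

Definition to_alg_closure (k : countFieldType) : {rmorphism k -> alg_closure k} :=
  sval (projT2 (countable_algebraic_closure k)).

Definition absolutely_irreducible (k : countFieldType) (F : {poly {poly k}}) : Prop :=
  irreducible_elt (map_poly (map_poly (to_alg_closure k)) F).

Section Monomials.

Variables (R : nzRingType) (F : {poly {poly R}}).

(* The bounds size F and sizeY F lose nothing: F`_i`_j = 0 beyond them. *)
Definition exponents : {set 'I_(size F) * 'I_(sizeY F)} :=
  [set ij : 'I_(size F) * 'I_(sizeY F) | F`_(ij.1)`_(ij.2) != 0].

Definition total_degree : nat := (\max_(ij in exponents) (ij.1 + ij.2))%N.

Definition delta : nat :=
  #|[set kl : 'I_(size F) * 'I_(sizeY F) |
      [exists ij in exponents, (kl.1 <= ij.1)%N && (kl.2 <= ij.2)%N]]|.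

End Monomials.

Definition Fp_interval (p : nat) (K : int) (H : nat) : {set 'F_p} :=
  [set (K + i%:Z)%:~R | i : 'I_H.+1].

Definition zero_count (p : nat) (F : {poly {poly 'F_p}}) (A B : {set 'F_p}) : nat :=
  #|[set ab in setX A B | F.[ab.1, ab.2] == 0]|.

(* Main.v *)
Require Import Defs.
From HB Require Import structures.
From mathcomp Require Import all_boot all_order all_algebra closed_field perm.
From mathcomp Require Import zify ring lra.

(** The curve is lifted to the integers, where the determinant method of Bombieri
    and Pila, in the p-adic form of Heath-Brown, gives the exponent 1/d.

    Lifting.  After a translation the zeros are integer points (x, y) with
    0 <= x, y <= H, and F is a combination of the delta monomials dividing its
    terms, since a translation creates no other monomial.  The values of these
    monomials at the points satisfy a linear relation modulo p, so every minor of
    order delta is divisible by p; for H larger than a constant, the hypothesis on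
    H makes every minor smaller than p (sum_divisor_degrees), so these minors
    vanish.  Cramer's rule then gives
    an integer polynomial G of degree at most d, nonzero modulo p, with
    coefficients bounded by a power of H, that vanishes at all the points
    (small_kernel, integral_model).  If G is not a multiple of F modulo p, then
    Bezout leaves O(1) points, and otherwise G is a lift of a multiple of F.

    Determinants.  A shear makes the coefficient of u^d in F a nonzero constant,
    where u and v are the new coordinates.  Let q be a prime not dividing
    dG/du at the point.  On the points with u fixed modulo q and v fixed modulo
    q^a, Hensel's lemma makes u a polynomial in v modulo any power of q, so a
    determinant of n monomials at n such points is divisible by
    q^(a n (n - 1) / 2) (det_branch_dvd).  For the n = dD monomials u^j v^i with
    j < d and i < D, it vanishes as soon as q^a exceeds about H^(1/d + O(1/D)).
    Hence some nonzero polynomial modulo p of degree less than d in u vanishes on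
    the class, which by Bezout has O(1) points (class_leq).  There are q^(a + 1)
    classes, and a minimal a gives H^(1/d + O(1/D)) points up to a power of q.

    The points with dG/du = 0 modulo p are O(1), again by Bezout, and for the others
    dG/du is a nonzero integer bounded by a power of H, so some prime q bounded by
    a power of log H does not divide it: otherwise a central binomial coefficient
    would divide a small power of it (exists_prime_not_dvd).  Summing over these
    primes and letting D grow gives the theorem (uniform_bound).

    Bezout's bound is always applied modulo p, where F is absolutely irreducible by
    hypothesis.  It follows from the resultant and Gauss's lemma
    (resultant_irreducible_neq0, common_zeros_leq). *)

Set Implicit Arguments.
Unset Strict Implicit.
Unset Printing Implicit Defensive.

Import Order.TTheory GRing.Theory Num.Theory.
Local Open Scope ring_scope.

(** * Values of bivariate polynomials *)

Lemma horner_fibre (R : comNzRingType) (F : {poly {poly R}}) (Q : {poly R}) v :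
  F.[Q].[v] = (map_poly (horner_eval v) F).[Q.[v]].
Proof. by rewrite -[Q.[v]]/(horner_eval v Q) horner_map. Qed.

Lemma horner_eval2 (R : comNzRingType) (F : {poly {poly R}}) u v :
  F.[u, v] = (map_poly (horner_eval v) F).[u].
Proof. by rewrite horner_fibre hornerC. Qed.

Lemma horner2_map (R R' : comNzRingType) (f : {rmorphism R -> R'}) (P : {poly {poly R}}) u v :
  (map_poly (map_poly f) P).[f u, f v] = f (P.[u, v]).
Proof. by rewrite -[(f u)%:P]map_polyC /= !horner_map. Qed.

Lemma horner2_wide (R : comNzRingType) (P : {poly {poly R}}) m n u v :
  (size P <= m)%N -> (sizeY P <= n)%N ->
  P.[u, v] = \sum_(l < m) \sum_(k < n) P`_l`_k * (u ^+ l * v ^+ k).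
Proof.
move=> sm sn; rewrite (horner_coef_wide _ sm) horner_sum; apply: eq_bigr => l _.
rewrite -polyC_exp hornerM hornerC (horner_coef_wide _ (leq_trans (max_size_coefXY P l) sn)).
by rewrite big_distrl; apply: eq_bigr => k _ /=; rewrite mulrAC mulrA.
Qed.

(** * Counting over finite sets *)

Lemma card_fiberwise (T U : finType) (f : T -> U) (A : {set T}) (B : {set U}) n :
  (forall t, t \in A -> f t \in B) ->
  (forall b, b \in B -> #|[set t in A | f t == b]| <= n)%N ->
  (#|A| <= #|B| * n)%N.
Proof.
move=> AB hn; rewrite -sum1_card (partition_big f (mem B)) //= -sum_nat_const.
apply: leq_sum => b /hn; apply: leq_trans; rewrite sum1dep_card.
by apply: eq_leq; apply: eq_card => t; rewrite !inE.
Qed.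

Lemma card_leq_sum_cover (T : finType) (A : {set T}) n (Q : pred 'I_n) (r : T -> 'I_n -> bool) :
  (forall t, t \in A -> exists2 q, Q q & r t q) ->
  (#|A| <= \sum_(q | Q q) #|[set t in A | r t q]|)%N.
Proof.
move=> cov; rewrite -sum1_card.
under [leqRHS]eq_bigr => q _ do rewrite -sum1dep_card big_mkcondr /=.
rewrite exchange_big /=; apply: leq_sum => t /cov[q Qq rtq].
by rewrite (bigD1 q) //= rtq.
Qed.

(** * Common zeros modulo p *)

Lemma factor_poly_map_root (K : fieldType) (a : K) (A : {poly {poly K}}) :
  map_poly (horner_eval a) A = 0 ->
  exists2 B : {poly {poly K}}, A = ('X - a%:P) *: B & size B = size A.
Proof.
move=> A0; have fz : 'X - a%:P != 0 :> {poly K} by rewrite polyXsubC_eq0.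
have E : A = ('X - a%:P) *: map_poly (fun c => c %/ ('X - a%:P)) A.
  apply/polyP=> i; rewrite coefZ coef_map_id0 ?div0p // mulrC divpK //.
  by rewrite dvdp_XsubCl /root -[_.[a]]/(horner_eval a _) -coef_map A0 coef0.
exists (map_poly (fun c => c %/ ('X - a%:P)) A) => //.
by rewrite [in RHS]E size_scale.
Qed.

(** Gauss's lemma in the form needed here: over an algebraically closed field the
    prime factors of the content c are linear, and reducing modulo X - a shows that
    X - a divides A or B, so that the factors of c can be removed one at a time. *)
Lemma gauss_split (K : closedFieldType) (c : {poly K}) (F A B : {poly {poly K}}) :
  c != 0 -> c *: F = A * B ->
  exists A' B', [/\ F = A' * B', size A' = size A & size B' = size B].
Proof.
have [n] := ubnP (size c); elim: n => // n IHn in c A B *.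
move=> szc c0 E; have [/size1_polyC ck | szc1] := leqP (size c) 1.
  move: c0 E; rewrite ck polyC_eq0 => k0 E; set k := c`_0 in k0 E.
  exists (k^-1%:P *: A), B; split; rewrite ?size_scale ?polyC_eq0 ?invr_eq0 //.
  by rewrite -scalerAl -E scalerA -polyCM mulVf ?scale1r.
have [a ra] : exists a, root c a by apply/closed_rootP; rewrite neq_ltn szc1 orbT.
have [c1 Dc] := factor_theorem _ _ ra.
have fz : 'X - a%:P != 0 :> {poly K} by rewrite polyXsubC_eq0.
have c10 : c1 != 0 by apply: contraNneq c0 => z; rewrite Dc z mul0r.
have szc' : (size c1 < n)%N.
  by move: szc; rewrite Dc size_Mmonic ?monicXsubC // size_XsubC addn2.
have AB0 : map_poly (horner_eval a) A * map_poly (horner_eval a) B = 0.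
  rewrite -rmorphM -E; apply/polyP=> i; rewrite coef_map coefZ coef0 /=.
  by rewrite /horner_eval hornerM (rootP ra) mul0r.
have [/eqP/factor_poly_map_root[A1 DA sA] | /eqP/factor_poly_map_root[B1 DB sB]] :
  (map_poly (horner_eval a) A == 0) \/ (map_poly (horner_eval a) B == 0).
  - by apply/orP; rewrite -mulf_eq0 AB0.
- rewrite -sA; apply: (IHn c1) => //.
  apply: (@mulfI _ ('X - a%:P)%:P); rewrite ?polyC_eq0 // !mul_polyC.
  by rewrite scalerA mulrC -Dc E DA scalerAl.
rewrite -sB; apply: (IHn c1) => //.
apply: (@mulfI _ ('X - a%:P)%:P); rewrite ?polyC_eq0 // !mul_polyC.
by rewrite scalerA mulrC -Dc E DB scalerAr.
Qed.

(** A zero resultant gives a common factor up to content; by Gauss's lemma F then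
    has a factor of size strictly between 1 and size F. *)
Lemma resultant_irreducible_neq0 (K : closedFieldType) (F P : {poly {poly K}}) :
  irreducible_elt F -> P != 0 -> (size P < size F)%N -> resultant F P != 0.
Proof.
move=> [F0 _ Firr] P0 szPF; rewrite resultant_eq0 -leqNgt leqNgt; apply/negP=> szg.
have /Pdiv.Idomain.dvdpP[[k Q] /= k0 E] := dvdp_gcdl F P.
have [A [B [EF sA sB]]] := gauss_split k0 E.
have szgP : (size (gcdp F P) <= size P)%N by rewrite dvdp_leq // dvdp_gcdr.
have := size_polyMleq A B; rewrite -EF sA sB => sF.
have [] := Firr _ _ EF; rewrite poly_unitE => /andP[/eqP s1 _].
  by move: sF; rewrite -sA s1 add1n /= leqNgt (leq_ltn_trans szgP).
by move: szg; rewrite -sB s1.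
Qed.

Lemma size_det_leq (R : comNzRingType) n m (M : 'M[{poly R}]_n) :
  (forall i j, size (M i j) <= m.+1)%N -> (size (\det M) <= (n * m).+1)%N.
Proof.
move=> szM; rewrite /determinant (leq_trans (size_sum _ _ _)) //.
apply/bigmax_leqP=> s _; rewrite mulr_sign.
set P := \prod_i _.
have sP : (size P <= (n * m).+1)%N.
  apply: leq_trans (size_poly_prod_leq _ _) _.
  rewrite leq_subLR cardT size_enum_ord.
  rewrite [X in (_ <= X)%N](_ : _ = (n * m.+1).+1); last by rewrite mulnS addnS.
  rewrite ltnS; apply: (@leq_trans (\sum_(i < n) m.+1)); first by apply: leq_sum.
  by rewrite sum_nat_const card_ord.
by case: ifP => _ //; rewrite size_polyN.
Qed.

Lemma size_resultant_leq (R : comNzRingType) (F P : {poly {poly R}}) m :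
  (sizeY F <= m.+1)%N -> (sizeY P <= m.+1)%N ->
  (size (resultant F P) <= (((size P).-1 + (size F).-1) * m).+1)%N.
Proof.
move=> hF hP; apply: size_det_leq => i j; rewrite Sylvester_mxE.
case: split => k; rewrite mulrb; case: ifP => _; rewrite ?size_poly0 //.
  exact: leq_trans (max_size_coefXY _ _) hF.
exact: leq_trans (max_size_coefXY _ _) hP.
Qed.

Lemma card_root_leq (k : finFieldType) (P : {poly k}) :
  P != 0 -> (#|[set x | P.[x] == 0%R]| <= (size P).-1)%N.
Proof.
move=> P0; rewrite cardE -ltnS prednK ?size_poly_gt0 //.
apply: max_poly_roots => //; last exact: enum_uniq.
by apply/allP=> x; rewrite mem_enum inE.
Qed.

(** Bezout's theorem for the inner coordinate: R is the resultant, which is defined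
    over k although its nonvanishing is seen over K.  When P does not involve the
    outer variable, R is P itself. *)
Lemma elimination (k : fieldType) (K : closedFieldType)
    (iota : {rmorphism k -> K}) (F P : {poly {poly k}}) d m :
  irreducible_elt (map_poly (map_poly iota) F) ->
  size F = d.+1 -> P != 0 -> (size P <= d)%N ->
  (sizeY F <= m.+1)%N -> (sizeY P <= m.+1)%N ->
  exists R : {poly k}, [/\ R != 0, (size R <= (2 * d * m).+1)%N &
    forall u v, F.[u, v] = 0 -> P.[u, v] = 0 -> R.[v] = 0].
Proof.
move=> Firr szF P0 szP hF hP.
have F0 : F != 0 by rewrite -size_poly_eq0 szF.
have d0 : (0 < d)%N by apply: leq_trans szP; rewrite size_poly_gt0.
have [sP1|sP1] := leqP (size P) 1.
  exists P`_0; have Du := size1_polyC sP1; split.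
  - by apply: contraNneq P0 => z; rewrite Du z.
  - by apply: leq_trans (max_size_coefXY P 0) (leq_trans hP _); rewrite ltnS leq_pmull // muln_gt0.
  - by move=> u v _; rewrite {1}Du hornerC.
exists (resultant F P); split.
- have mF : map_poly iota (lead_coef F) != 0 by rewrite map_poly_eq0 lead_coef_eq0.
  have mP : map_poly iota (lead_coef P) != 0 by rewrite map_poly_eq0 lead_coef_eq0.
  rewrite -(map_poly_eq0 iota) map_resultant //; apply: resultant_irreducible_neq0 => //.
    by rewrite map_poly_eq0_id0.
  by rewrite !size_map_poly_id0 // szF.
- apply: leq_trans (size_resultant_leq hF hP) _.
  by rewrite ltnS leq_mul2r szF /=; rewrite mul2n -addnn leq_add2r (leq_trans (leq_pred _)) ?orbT.
- move=> u v Fuv Puv; have [|//|[A B] /= _ E] := @resultant_in_ideal _ F P.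
    by rewrite szF ltnS.
  rewrite -[resultant F P](hornerC _ u%:P) E.
  by rewrite !hornerE Fuv Puv !mulr0 addr0.
Qed.

(** A weak form of Bezout's theorem.  The constant leading coefficient of F bounds
    the number of zeros above each root of the eliminant. *)
Lemma common_zeros_leq (k : finFieldType) (K : closedFieldType)
    (iota : {rmorphism k -> K}) (F P : {poly {poly k}}) d m (c : k) :
  irreducible_elt (map_poly (map_poly iota) F) ->
  size F = d.+1 -> F`_d = c%:P -> P != 0 -> (size P <= d)%N ->
  (sizeY F <= m.+1)%N -> (sizeY P <= m.+1)%N ->
  (#|[set uv : k * k | (F.[uv.1, uv.2] == 0%R) && (P.[uv.1, uv.2] == 0%R)]|
     <= 2 * d * m * d)%N.
Proof.
move=> Firr szF lcF P0 szP hF hP.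
have c0 : c != 0.
  have : F != 0 by rewrite -size_poly_eq0 szF.
  by rewrite -lead_coef_eq0 lead_coefE szF /= lcF polyC_eq0.
have [R [R0 szR hR]] := elimination Firr szF P0 szP hF hP.
have F_line v : (#|[set u | F.[u, v] == 0%R]| <= d)%N.
  have szx : size (map_poly (horner_eval v) F) = d.+1.
    by rewrite size_map_poly_id0 // lead_coefE szF /= lcF /horner_eval hornerC.
  have := @card_root_leq _ (map_poly (horner_eval v) F).
  rewrite -size_poly_eq0 szx /= => /(_ isT); congr (_ <= _)%N.
  by apply: eq_card => y; rewrite !inE horner_eval2.
apply: leq_trans (_ : #|[set v | R.[v] == 0%R]| * d <= _)%N; last first.
  rewrite leq_mul2r; apply/orP; right; apply: leq_trans (card_root_leq R0) _.
  by rewrite -ltnS prednK // size_poly_gt0.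
apply: (card_fiberwise (f := snd)) => [[u v]|v _].
  by rewrite !inE /= => /andP[/eqP Fuv /eqP Puv]; rewrite (hR u v).
apply: leq_trans (F_line v).
rewrite -(card_in_imset (f := fst) (D := [set _ in _ | _])).
  apply: subset_leq_card; apply/subsetP=> u /imsetP[[u' v']].
  by rewrite !inE /= => /andP[/andP[Fuv _] /eqP <-] ->.
by move=> [u1 v1] [u2 v2]; rewrite !inE /= => /andP[_ /eqP->] /andP[_ /eqP->] ->.
Qed.

(** * Linear changes of variables and total degree *)

(** The polynomial F(x + K + t u, u + L) with u as its outer variable and x as its
    inner one: translation by (K, L) combined with a shear, as a composition of three
    ring automorphisms.  The shear makes the coefficient of the highest power of u
    constant. *)
Definition linear_change (R : comNzRingType) (t K L : R) (F : {poly {poly R}}) :=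
  swapXY (F \Po ('X + ((K - t * L)%:P + t *: 'X)%:P)) \Po ('X + L%:P%:P).

Section LinearChange.
Variable R : comNzRingType.
Implicit Types (F : {poly {poly R}}) (t K L : R).

Fact linear_change_is_zmod_morphism t K L : zmod_morphism (linear_change t K L).
Proof. by move=> F G; rewrite /linear_change comp_polyB raddfB comp_polyB. Qed.
Fact linear_change_is_monoid_morphism t K L : monoid_morphism (linear_change t K L).
Proof.
split=> [|F G]; rewrite /linear_change; last by rewrite comp_polyM rmorphM comp_polyM.
by rewrite comp_polyC swapXY_polyC map_polyC comp_polyC.
Qed.
HB.instance Definition _ t K L :=
  GRing.isZmodMorphism.Build {poly {poly R}} {poly {poly R}} (linear_change t K L)
    (linear_change_is_zmod_morphism t K L).
HB.instance Definition _ t K L :=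
  GRing.isMonoidMorphism.Build {poly {poly R}} {poly {poly R}} (linear_change t K L)
    (linear_change_is_monoid_morphism t K L).

Lemma comp_shiftK (S : comNzRingType) (h : S) :
  cancel (comp_poly ('X + h%:P)) (comp_poly ('X + (- h)%:P)).
Proof.
by move=> p; rewrite -comp_polyA comp_polyD comp_polyX comp_polyC polyCN subrK comp_polyXr.
Qed.

Lemma comp_unshiftK (S : comNzRingType) (h : S) :
  cancel (comp_poly ('X + (- h)%:P)) (comp_poly ('X + h%:P)).
Proof. by rewrite -{2}[h]opprK; apply: comp_shiftK. Qed.

Definition linear_change_inv t K L F :=
  swapXY (F \Po ('X + (- L%:P)%:P)) \Po ('X + (- ((K - t * L)%:P + t *: 'X))%:P).

Lemma linear_changeK t K L : cancel (linear_change t K L) (linear_change_inv t K L).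
Proof. by move=> F; rewrite /linear_change_inv comp_shiftK swapXYK comp_shiftK. Qed.

Lemma linear_change_invK t K L : cancel (linear_change_inv t K L) (linear_change t K L).
Proof.
by move=> F; rewrite /linear_change /linear_change_inv comp_unshiftK swapXYK comp_unshiftK.
Qed.

Lemma linear_change_horner t K L F u v :
  (linear_change t K L F).[u, v] = F.[v + K + t * u, u + L].
Proof.
rewrite /linear_change horner_comp hornerD hornerX hornerC -polyCD horner2_swapXY.
rewrite horner_comp hornerD hornerX hornerC [LHS]horner_fibre -horner_eval2.
rewrite !(hornerD, hornerZ, hornerC, hornerX). by congr (horner (horner F (polyC _)) _); ring.
Qed.

Lemma linear_change_X t K L : linear_change t K L 'X = 'X%:P + K%:P%:P + t%:P *: 'X.
Proof.
rewrite /linear_change comp_polyX raddfD /= swapXY_X swapXY_polyC comp_polyD comp_polyC.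
rewrite raddfD /= map_polyC map_polyZ map_polyX /= comp_polyD comp_polyC comp_polyZ comp_polyX.
by rewrite polyCB polyCM polyCB polyCM -!mul_polyC; ring.
Qed.

Lemma linear_change_Y t K L : linear_change t K L 'Y = 'X + L%:P%:P.
Proof.
by rewrite /linear_change comp_polyC swapXY_Y comp_polyX.
Qed.

Lemma linear_change_C t K L (c : R) : linear_change t K L c%:P%:P = c%:P%:P.
Proof.
by rewrite /linear_change comp_polyC swapXY_polyC map_polyC comp_polyC.
Qed.

Lemma bivariate_expand F :
  F = \sum_(i < size F) \sum_(j < sizeY F) (F`_i`_j)%:P%:P * 'X ^+ i * 'Y ^+ j.
Proof.
rewrite -[LHS]coefK poly_def; apply: eq_bigr => i _.
rewrite -mul_polyC -{1}[F`_i]coefK poly_def.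
rewrite (big_ord_widen _ (fun j => (F`_i)`_j *: 'X^j)  (max_size_coefXY F i)) big_mkcond.
rewrite rmorph_sum big_distrl; apply: eq_bigr => j _ /=.
case: ifP => [_|/negbT]; last first.
  by rewrite -leqNgt => /(nth_default 0)->; rewrite !mul0r.
by rewrite -mul_polyC rmorphM /= rmorphXn /= mulrAC.
Qed.

Lemma linear_change_expand t K L F : linear_change t K L F =
   \sum_(i < size F) \sum_(j < sizeY F) (F`_i`_j)%:P%:P *
     ('X%:P + K%:P%:P + t%:P *: 'X) ^+ i * ('X + L%:P%:P) ^+ j.
Proof.
rewrite {1}[F]bivariate_expand rmorph_sum; apply: eq_bigr => i _.
rewrite rmorph_sum; apply: eq_bigr => j _.
by rewrite !rmorphM /= !rmorphXn /= linear_change_C linear_change_X linear_change_Y.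
Qed.

(** An upper bound on the total degree, stable under sums and products even when
    leading terms cancel. *)
Definition tdeg_le d F := forall i j, (d < i + j)%N -> F`_i`_j = 0.

Lemma tdeg_leD d F G : tdeg_le d F -> tdeg_le d G -> tdeg_le d (F + G).
Proof. by move=> hF hG i j h; rewrite !coefD hF ?hG ?addr0. Qed.

Lemma tdeg_le0 d : tdeg_le d (0 : {poly {poly R}}).
Proof. by move=> i j _; rewrite !coef0. Qed.

Lemma tdeg_leC d (c : R) : tdeg_le d c%:P%:P.
Proof.
by move=> [|i] [|j] h; rewrite coefC /= ?coef0 // coefC.
Qed.

Lemma coefMXY F G i j :
  (F * G)`_i`_j = \sum_(a < i.+1) \sum_(b < j.+1) F`_a`_b * G`_(i - a)`_(j - b).
Proof. by rewrite coefM coef_sum; apply: eq_bigr => a _; rewrite coefM. Qed.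

Lemma tdeg_leM m n F G : tdeg_le m F -> tdeg_le n G -> tdeg_le (m + n) (F * G).
Proof.
move=> hF hG i j h; rewrite coefMXY big1 // => a _; rewrite big1 // => b _.
have [ab|ab] := ltnP m (a + b); first by rewrite hF ?mul0r.
have ia := ltn_ord a; have jb := ltn_ord b.
by rewrite [G`__`__]hG ?mulr0 //; lia.
Qed.

Lemma tdeg_leX n F k : tdeg_le n F -> tdeg_le (k * n) (F ^+ k).
Proof.
move=> hF; elim: k => [|k IHk]; first by rewrite expr0; apply: tdeg_leC.
by rewrite exprS mulSn; apply: tdeg_leM.
Qed.

Lemma tdeg_leW m n F : (m <= n)%N -> tdeg_le m F -> tdeg_le n F.
Proof. by move=> mn hF i j h; apply: hF; apply: leq_ltn_trans h. Qed.

Lemma tdeg_le_sum (I : Type) (r : seq I) (P : pred I) d (f : I -> {poly {poly R}}) :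
  (forall i, P i -> tdeg_le d (f i)) -> tdeg_le d (\sum_(i <- r | P i) f i).
Proof.
by move=> hf; elim/big_ind: _ => //; [apply: tdeg_le0 | apply: tdeg_leD].
Qed.

Lemma top_coefM m n F G : tdeg_le m F -> tdeg_le n G ->
  (F * G)`_(m + n)`_0 = F`_m`_0 * G`_n`_0.
Proof.
move=> hF hG; rewrite coefMXY.
have mn : (m < (m + n).+1)%N by rewrite ltnS leq_addr.
rewrite (bigD1 (Ordinal mn)) //= big_ord1 addKn big1 ?addr0 // => a am.
rewrite big_ord1 /=; have {am} : (a : nat) != m by apply: contraNneq am => am; apply/eqP/val_inj.
rewrite neq_ltn => /orP[am|am]; last by rewrite hF ?mul0r // addn0.
by rewrite [G`__`__]hG ?mulr0 //; have := ltn_ord a; lia.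
Qed.

Lemma top_coefX n F k : tdeg_le n F -> (F ^+ k)`_(k * n)`_0 = F`_n`_0 ^+ k.
Proof.
move=> hF; elim: k => [|k IHk]; first by rewrite !expr0 mul0n !coefC.
by rewrite !exprS mulSn top_coefM ?IHk //; apply: tdeg_leX.
Qed.

Lemma tdeg_le_pow F k : tdeg_le 1 F -> tdeg_le k (F ^+ k).
Proof. by move=> hF; have := @tdeg_leX 1 F k hF; rewrite muln1. Qed.

Lemma top_coef_pow F k : tdeg_le 1 F -> (F ^+ k)`_k`_0 = F`_1`_0 ^+ k.
Proof. by move=> hF; have := @top_coefX 1 F k hF; rewrite muln1. Qed.

Lemma tdeg_leX1 : tdeg_le 1 ('X : {poly {poly R}}).
Proof. by move=> [|[|i]] [|[|j]] h; rewrite coefX /= ?coef0 ?coef1. Qed.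

Lemma tdeg_leY1 : tdeg_le 1 ('Y : {poly {poly R}}).
Proof. by move=> [|i] [|[|j]] h; rewrite coefC /= ?coef0 ?coefX. Qed.

Lemma tdeg_le_affineX t K : tdeg_le 1 ('X%:P + K%:P%:P + t%:P *: 'X : {poly {poly R}}).
Proof.
apply: tdeg_leD; first apply: tdeg_leD.
- exact: tdeg_leY1.
- exact: (tdeg_leW (leq0n _) (tdeg_leC _)).
- by rewrite -mul_polyC; apply: (@tdeg_leM 0 1); [apply: tdeg_leC|apply: tdeg_leX1].
Qed.

Lemma tdeg_le_affineY L : tdeg_le 1 ('X + L%:P%:P : {poly {poly R}}).
Proof.
by apply: tdeg_leD; [apply: tdeg_leX1 | apply: (tdeg_leW (leq0n _) (tdeg_leC _))].
Qed.

Lemma linear_change_monomial_tdeg c t K L i j : tdeg_le (i + j)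
  (c%:P%:P * ('X%:P + K%:P%:P + t%:P *: 'X) ^+ i * ('X + L%:P%:P) ^+ j : {poly {poly R}}).
Proof.
apply: tdeg_leM; last exact/tdeg_le_pow/tdeg_le_affineY.
by apply: (@tdeg_leM 0); [exact: tdeg_leC | exact/tdeg_le_pow/tdeg_le_affineX].
Qed.

Lemma linear_change_monomial_top c t K L i j :
  (c%:P%:P * ('X%:P + K%:P%:P + t%:P *: 'X) ^+ i * ('X + L%:P%:P) ^+ j
    : {poly {poly R}})`_(i + j)`_0 = c * t ^+ i.
Proof.
have dX : tdeg_le i (('X%:P + K%:P%:P + t%:P *: 'X) ^+ i : {poly {poly R}}).
  exact/tdeg_le_pow/tdeg_le_affineX.
have dY : tdeg_le j (('X + L%:P%:P) ^+ j : {poly {poly R}}).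
  exact/tdeg_le_pow/tdeg_le_affineY.
rewrite top_coefM //; last by apply: (@tdeg_leM 0) => //; apply: tdeg_leC.
rewrite -[i in _`_i]add0n (@top_coefM 0) //; last exact: tdeg_leC.
rewrite (top_coef_pow _ (@tdeg_le_affineX t K)) (top_coef_pow _ (@tdeg_le_affineY L)).
rewrite !(coefD, coefZ, coefC, coefX) /= !(add0r, addr0, coef1, mulr1, expr1n).
by rewrite coefC.
Qed.

Lemma linear_change_tdeg d t K L F :
  tdeg_le d F -> tdeg_le d (linear_change t K L F).
Proof.
move=> hF; rewrite linear_change_expand; apply: tdeg_le_sum => i _.
apply: tdeg_le_sum => j _; have [ij|ij] := ltnP d (i + j).
  by rewrite hF // !mul0r; apply: tdeg_le0.
by apply: tdeg_leW ij _; apply: linear_change_monomial_tdeg.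
Qed.

Lemma tdeg_le_coef_size d F i : tdeg_le d F -> (size (F`_i)%R <= (d - i).+1)%N.
Proof. by move=> hF; apply/leq_sizeP => j h; apply: hF; lia. Qed.

Lemma tdeg_le_size d F : tdeg_le d F -> (size F <= d.+1)%N.
Proof.
move=> hF; apply/leq_sizeP => i h; apply/polyP => j; rewrite coef0; apply: hF; lia.
Qed.

Lemma tdeg_le_sizeY d F : tdeg_le d F -> (sizeY F <= d.+1)%N.
Proof.
move=> hF; apply/bigmax_leqP => i _; apply: leq_trans (tdeg_le_coef_size _ hF) _.
by rewrite ltnS leq_subr.
Qed.

Lemma tdeg_le_lead d F : tdeg_le d F -> F`_d = (F`_d`_0)%:P.
Proof.
by move=> hF; apply: size1_polyC; have := tdeg_le_coef_size d hF; rewrite subnn.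
Qed.

(** Only the terms of total degree d contribute to the coefficient of u^d, where a
    term of exponents (i, d - i) gives t^i; so the coefficient is a polynomial in the
    shear parameter t whose coefficients are those of the leading form of F. *)
Lemma linear_change_top d t K L F : tdeg_le d F ->
  (linear_change t K L F)`_d`_0 = \sum_(i < d.+1) F`_i`_(d - i) * t ^+ i.
Proof.
move=> hF; rewrite linear_change_expand !coef_sum.
have sF := tdeg_le_size hF; have sYF := tdeg_le_sizeY hF.
transitivity (\sum_(i < size F) F`_i`_(d - i) * t ^+ i); last first.
  rewrite (big_ord_widen _ (fun i => F`_i`_(d - i) * t ^+ i) sF) big_mkcond.
  apply: eq_bigr => i _; case: ifP => // /negbT; rewrite -leqNgt => h.
  by rewrite [F`_i]nth_default // coef0 mul0r.
apply: eq_bigr => i _; rewrite !coef_sum.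
have id : (i <= d)%N by rewrite -ltnS (leq_trans _ sF).
have off j : (i + j)%N != d -> ((F`_i`_j)%:P%:P * ('X%:P + K%:P%:P + t%:P *: 'X) ^+ i *
    ('X + L%:P%:P) ^+ j)`_d`_0 = 0.
  rewrite neq_ltn => /orP[h|h]; last by rewrite hF // !mul0r !coef0.
  by apply: (@linear_change_monomial_tdeg (F`_i`_j) t K L i j); rewrite addn0.
have [ltY|geY] := ltnP (d - i) (sizeY F).
  rewrite (bigD1 (Ordinal ltY)) //= big1 ?addr0 => [|j jd].
    have := linear_change_monomial_top (F`_i`_(d - i)) t K L i (d - i).
    by rewrite subnKC.
  apply: off; apply: contraNneq jd => jd; apply/eqP/val_inj => /=.
  by rewrite -jd addKn.
rewrite big1 => [|j _].
  rewrite [_`_(d - i)]nth_default ?mul0r // (leq_trans (max_size_coefXY F i)) //.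
apply: off; apply: contraTneq geY => jd.
by rewrite -ltnNge -jd addKn.
Qed.

End LinearChange.

Lemma linear_change_map (R S : comNzRingType) (f : {rmorphism R -> S}) t K L F :
  map_poly (map_poly f) (linear_change t K L F) =
  linear_change (f t) (f K) (f L) (map_poly (map_poly f) F).
Proof.
rewrite /linear_change map_comp_poly raddfD /= map_polyX map_polyC /= map_polyC /=.
rewrite -swapXY_map map_comp_poly raddfD /= map_polyX map_polyC /=.
by rewrite raddfD /= map_polyC /= map_polyZ map_polyX rmorphB rmorphM.
Qed.

(** The inverse of a bijective morphism is automatically multiplicative, so
    factorizations and units are transported both ways. *)
Lemma irreducible_iso (A B : idomainType) (f : {rmorphism A -> B}) (g : B -> A) a :
  cancel f g -> cancel g f -> irreducible_elt a -> irreducible_elt (f a).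
Proof.
move=> fK gK [a0 aU aI].
have gM b c : g (b * c) = g b * g c by rewrite -{1}(gK b) -{1}(gK c) -rmorphM fK.
have g1 : g 1 = 1 by rewrite -(rmorph1 f) fK.
have gU b : g b \is a GRing.unit -> b \is a GRing.unit.
  by move=> u; rewrite -(gK b) rmorph_unit.
split.
- by apply: contraNneq a0 => fa; rewrite -(fK a) fa -(rmorph0 f) fK.
- apply: contra aU => /unitrP[v [vfa fav]]; apply/unitrP; exists (g v).
  by split; apply: (can_inj fK); rewrite rmorphM gK ?vfa ?fav rmorph1.
move=> b c E; have [|/gU|/gU] := aI (g b) (g c); [|by left|by right].
by rewrite -gM -E fK.
Qed.

Lemma linear_change_neq0 (R : comNzRingType) (t x y : R) (P : {poly {poly R}}) :
  P != 0 -> linear_change t x y P != 0.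
Proof.
apply: contraNneq => z; rewrite -(linear_changeK t x y P) z.
by rewrite /linear_change_inv !(comp_poly0, raddf0).
Qed.

Lemma linear_change_irreducible (k : countFieldType) (P : {poly {poly k}}) (t x y : k) :
  absolutely_irreducible P -> absolutely_irreducible (linear_change t x y P).
Proof.
rewrite /absolutely_irreducible linear_change_map.
apply: (irreducible_iso (g := linear_change_inv _ _ _)).
  exact: linear_changeK.
exact: linear_change_invK.
Qed.

(** * Determinants along a branch modulo prime powers *)

Lemma taylor2 (R : comNzRingType) (p : {poly R}) (x h : R) :
  exists r, p.[x + h] = p.[x] + h * p^`().[x] + h ^+ 2 * r.
Proof.
elim/poly_ind: p => [|p c [r IH]].
  by exists 0; rewrite deriv0 !horner0; ring.
exists (x * r + p^`().[x] + h * r).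
rewrite !hornerE IH derivD derivM derivX derivC !hornerE; ring.
Qed.

(** Newton iteration with a constant slope w, an inverse of the derivative modulo q:
    replacing f by f - w G(f, v) multiplies the error u - f(v) by
    1 - w G'(u, v) plus a multiple of the error, hence by a multiple of q.  The
    polynomial f is the same for all points of the residue class. *)
Lemma hensel_branch (G : {poly {poly int}}) (q w u0 : int) N :
  exists f : {poly int}, forall u v : int, G.[u, v] = 0 -> (q %| u - u0)%Z ->
    (q %| w * G^`().[u, v] - 1)%Z -> (q ^+ N.+1 %| u - f.[v])%Z.
Proof.
elim: N => [|N [f IH]].
  by exists u0%:P => u v _ h _; rewrite expr1 hornerC.
exists (f - w *: G.[f]) => u v Guv hu hw.
have /dvdzP[e De] := IH u v Guv hu hw; have /dvdzP[b Db] := hw.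
set g := map_poly (horner_eval v) G.
have gf : G.[f].[v] = g.[f.[v]] by apply: horner_fibre.
have [r Dr] := taylor2 g u (f.[v] - u).
have g' : g^`().[u] = G^`().[u, v] by rewrite horner_eval2 deriv_map.
have g0 : g.[u] = 0 by rewrite -horner_eval2.
have Df : f.[v] - u = - (e * q ^+ N.+1) by rewrite -De opprB.
have Dw : w * G^`().[u, v] = b * q + 1 by rewrite -Db subrK.
have {Dr} Dg : g.[f.[v]] = - (e * q ^+ N.+1) * G^`().[u, v] + (e * q ^+ N.+1) ^+ 2 * r.
  by have := Dr; rewrite [u + _]addrC subrK g0 add0r g' Df sqrrN.
rewrite hornerD hornerN hornerZ gf Dg.
apply/dvdzP; exists (- (e * b) + w * e ^+ 2 * q ^+ N * r).
have -> : u - (f.[v] - w * (- (e * q ^+ N.+1) * G^`().[u, v] + (e * q ^+ N.+1) ^+ 2 * r))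
    = (u - f.[v]) - e * q ^+ N.+1 * (w * G^`().[u, v]) + w * (e * q ^+ N.+1) ^+ 2 * r by ring.
by rewrite De Dw !exprS expr0; ring.
Qed.

(** The divided differences of a polynomial with coefficients in R lie in R. *)
Lemma newton_interpolation (R : comNzRingType) (g : {poly R}) (x : nat -> R) n :
  exists c : nat -> R, exists r, g =
    \sum_(k < n) c k *: \prod_(l < k) ('X - (x l)%:P) + r * \prod_(l < n) ('X - (x l)%:P).
Proof.
elim: n => [|n [c [r IH]]].
  by exists (fun=> 0), g; rewrite !big_ord0 add0r mulr1.
have [s Ds] : exists s, r = s * ('X - (x n)%:P) + (r.[x n])%:P.
  have /factor_theorem[s Ds] : root (r - (r.[x n])%:P) (x n).
    by rewrite /root !hornerE subrr.
  by exists s; rewrite -Ds subrK.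
exists (fun k => if k == n then r.[x n] else c k), s.
rewrite !big_ord_recr /= eqxx {1}IH {1}Ds.
rewrite mulrDl mul_polyC addrA [s * _ * _]mulrAC -mulrA.
rewrite [LHS]addrAC; congr (_ + _ + _).
by apply: eq_bigr => k _; rewrite ltn_eqF.
Qed.

Lemma sum_ord_bin n : (\sum_(k < n) k = 'C(n, 2))%N.
Proof. by rewrite -(big_mkord xpredT id) bin2_sum. Qed.

Lemma dvdz_prod (I : finType) (f g : I -> int) :
  (forall i, f i %| g i)%Z -> (\prod_i f i %| \prod_i g i)%Z.
Proof. by move=> h; elim/big_rec2: _ => // i y z _ hyz; apply: dvdz_mul. Qed.

(** In the Newton basis the matrix of values is a product of an integral matrix and
    a triangular one whose k-th diagonal entry is a product of k differences of
    nodes, each divisible by m. *)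
Lemma det_poly_values_dvd n (g : 'I_n -> {poly int}) (x : 'I_n -> int) (m : int) :
  (forall i j, (m %| x i - x j)%Z) ->
  (m ^+ 'C(n, 2) %| \det (\matrix_(a, i) (g a).[x i]))%Z.
Proof.
move=> hx; pose y k := if insub k is Some i then x i else 0.
have yE (i : 'I_n) : y i = x i by rewrite /y valK.
have /fin_all_exists[c hc] a := newton_interpolation (g a) y n.
pose C := \matrix_(a < n, k < n) c a k.
pose B := \matrix_(k < n, i < n) \prod_(l < k) (x i - y l).
have -> : \matrix_(a, i) (g a).[x i] = C *m B.
  apply/matrixP=> a i; rewrite !mxE; have [r ->] := hc a.
  rewrite hornerD hornerM horner_sum.
  rewrite [X in _ * X](_ : _ = 0) ?mulr0 ?addr0.
    apply: eq_bigr => k _; rewrite !mxE hornerZ horner_prod; congr (_ * _).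
    by apply: eq_bigr => l _; rewrite !hornerE.
  by rewrite horner_prod (bigD1 i) //= yE !hornerE subrr mul0r.
have trigB : is_trig_mx B^T.
  apply/is_trig_mxP => i k ik; rewrite !mxE (bigD1 (Ordinal ik)) //=.
  by rewrite yE subrr mul0r.
rewrite det_mulmx -[\det B]det_tr (det_trig trigB).
apply: dvdz_mull; rewrite -sum_ord_bin expr_sum.
apply: dvdz_prod => k.
have -> : m ^+ k = \prod_(l < k) m by rewrite prodr_const card_ord.
rewrite !mxE.
apply: dvdz_prod => l.
have lk : (l < n)%N by apply: ltn_trans (ltn_ord l) (ltn_ord k).
by rewrite -[y l]/(y (Ordinal lk)) yE.
Qed.

Lemma dvdz_det_sub n (A B : 'M[int]_n) (m : int) :
  (forall i j, (m %| A i j - B i j)%Z) -> (m %| \det A - \det B)%Z.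
Proof.
move=> hAB; rewrite /determinant.
apply: (big_ind2 (fun y z : int => (m %| y - z)%Z)) => [|a a' b b' h h'|s _].
- by rewrite subrr dvdz0.
- have -> : a + b - (a' + b') = (a - a') + (b - b') by ring.
  exact: rpredD.
rewrite -mulrBr dvdz_mull //.
apply: (big_ind2 (fun y z : int => (m %| y - z)%Z)) => [|a a' b b' h h'|i _ //].
- by rewrite subrr dvdz0.
have -> : a * b - a' * b' = (a - a') * b + a' * (b - b') by ring.
by apply: rpredD; [apply: dvdz_mulr | apply: dvdz_mull].
Qed.

Lemma dvdz_horner_sub (p : {poly int}) (m x y : int) :
  (m %| x - y)%Z -> (m %| p.[x] - p.[y])%Z.
Proof.
have /factor_theorem[s Ds] : root (p - (p.[y])%:P) y by rewrite /root !hornerE subrr.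
have -> : p.[x] - p.[y] = s.[x] * (x - y).
  by have := congr1 (horner^~ x) Ds; rewrite !hornerE.
exact: dvdz_mull.
Qed.

(** Along a branch u = f(v) every monomial in u and v is a polynomial in v alone, up
    to a high power of q, so the values behave like those of polynomials at nodes
    that agree modulo q^a. *)
Lemma det_branch_dvd (G : {poly {poly int}}) (q w u0 : int) a n
    (mon : 'I_n -> {poly {poly int}}) (U V : 'I_n -> int) :
  (forall i, G.[U i, V i] = 0) -> (forall i, (q %| U i - u0)%Z) ->
  (forall i, (q %| w * G^`().[U i, V i] - 1)%Z) ->
  (forall i j, (q ^+ a %| V i - V j)%Z) ->
  (q ^+ (a * 'C(n, 2)) %| \det (\matrix_(k, i) (mon k).[U i, V i]))%Z.
Proof.
move=> hG hU hw hV; have [f hf] := hensel_branch G q w u0 (a * 'C(n, 2)).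
have hd := @det_poly_values_dvd n (fun k => (mon k).[f]) V (q ^+ a) hV.
rewrite -[\det _](subrK (\det (\matrix_(k, i) (mon k).[f].[V i]))).
rewrite rpredD //; last by rewrite exprM.
apply: dvdz_det_sub => k i; rewrite !mxE horner_eval2 horner_fibre.
apply: dvdz_horner_sub; apply: dvdz_trans (hf _ _ (hG i) (hU i) (hw i)).
by rewrite exprS dvdz_mull.
Qed.

Lemma det_bound (R : numDomainType) n (M : 'M[R]_n) (b : 'I_n -> R) :
  (forall i j, `|M i j| <= b i) -> `|\det M| <= n`!%:R * \prod_i b i.
Proof.
move=> hM; apply: le_trans (ler_norm_sum _ _ _) _.
apply: (@le_trans _ _ (\sum_(s : 'S_n) \prod_i b i)).
  apply: ler_sum => s _; rewrite normrM normr_sign mul1r normr_prod.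
  by apply: ler_prod => i _; rewrite normr_ge0 hM.
by rewrite sumr_const card_Sn mulr_natl.
Qed.

(** * Linear relations between integer columns *)

Lemma kernel_of_minors (k : fieldType) s n (M : 'M[k]_(s, n)) :
  (forall f : 'I_s -> 'I_n, \det (colsub f M) = 0) ->
  exists2 c : 'rV[k]_s, c != 0 & c *m M = 0.
Proof.
move=> hM; have nfree : ~~ row_free M.
  apply/negP => frM.
  have fullT : row_full M^T by rewrite /row_full mxrank_tr.
  have := hM (fullrankfun fullT); apply/eqP; rewrite -det_tr -unitfE -unitmxE.
  rewrite -row_full_unit.
  have -> : (colsub (fullrankfun fullT) M)^T = rowsub (fullrankfun fullT) M^T.
    by apply/matrixP=> i j; rewrite !mxE.
  exact: fullrowsub_full.
have k0 : kermx M != 0 by rewrite kermx_eq0.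
exists (nz_row (kermx M)); first by rewrite nz_row_eq0.
by apply/sub_kermxP; apply: nz_row_sub.
Qed.

(** The form of kernel_of_minors in which rows and columns are indexed by arbitrary
    finite sets, used with monomials as rows and points as columns. *)
Lemma kernel_of_minors_on (k : fieldType) (I T : finType) (S : {set T}) (M : I -> T -> k) :
  (forall f : 'I_#|I| -> T, (forall j, f j \in S) ->
     \det (\matrix_(i, j) M (enum_val i) (f j)) = 0) ->
  exists2 c : I -> k, (exists i, c i != 0) & forall t, t \in S -> \sum_i c i * M i t = 0.
Proof.
move=> hM; pose Mx := \matrix_(i < #|I|, j < #|S|) M (enum_val i) (enum_val j).
have [f|c c0 cM] := @kernel_of_minors k _ _ Mx.
  rewrite -[RHS](hM (fun j => enum_val (f j))); last by move=> j; apply: enum_valP.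
  by congr (\det _); apply/matrixP=> i j; rewrite !mxE.
exists (fun i => c 0 (enum_rank i)).
  have /rV0Pn[i ci] := c0.
  by exists (enum_val i); rewrite enum_valK.
move=> t tS; have /rowP/(_ (enum_rank_in tS t)) := cM; rewrite !mxE => cMt.
rewrite (reindex (enum_val : 'I_#|I| -> I)) /=; last exact/onW_bij/enum_val_bij.
rewrite -[RHS]cMt; apply: eq_bigr => i _; rewrite !mxE enum_valK enum_rankK_in // tS.
Qed.

Section SmallKernel.
Variables (s n : nat) (M : 'M[int]_(s, n)).

Let Mq : 'M[rat]_(s, n) := map_mx intr M.

(** With a maximal nonsingular minor, given by g and h, and another row k, Cramer's
    rule expresses row k through the rows of the minor with cofactors as
    coefficients.  This is how a relation with integer coefficients of controlled
    size is obtained. *)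
Lemma deficient_relation : (\rank Mq < s)%N ->
  exists r (g : 'I_r -> 'I_s) (h : 'I_r -> 'I_n) (k : 'I_s),
   [/\ injective g, forall a, g a != k, (r <= s)%N,
     \det (mxsub g h M) != 0 &
     forall j, \det (mxsub g h M) * M k j =
      \sum_a (row k (colsub h M) *m \adj (mxsub g h M)) 0 a * M (g a) j].
Proof.
move=> rs; set r := \rank Mq in rs; pose g := maxrankfun Mq.
have gI : injective g by exact: maxrankfun_inj.
have [k kg] : exists k : 'I_s, k \notin codom g.
  apply/existsP; rewrite -negb_forall; apply/negP => /forallP all_g.
  have : (#|'I_s| <= #|codom g|)%N by apply: subset_leq_card; apply/subsetP=> x _; apply: all_g.
  by rewrite card_codom // !card_ord leqNgt rs.
have fullT : row_full (rowsub g Mq)^T by rewrite /row_full mxrank_tr; apply: maxrowsub_free.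
pose h := fullrankfun fullT.
have Nunit : mxsub g h Mq \in unitmx.
  rewrite -unitmx_tr -row_full_unit.
  have -> : (mxsub g h Mq)^T = rowsub h (rowsub g Mq)^T.
    by apply/matrixP=> i j; rewrite !mxE.
  exact: fullrowsub_full.
have Ndet : \det (mxsub g h Mq) = (\det (mxsub g h M))%:~R.
  by rewrite -det_map_mx; congr (\det _); apply/matrixP=> i j; rewrite !mxE.
have Nadj : \adj (mxsub g h Mq) = map_mx intr (\adj (mxsub g h M)).
  by rewrite map_mx_adj; congr (\adj _); apply/matrixP=> i j; rewrite !mxE.
exists r, g, h, k; split => //.
- by move=> a; apply: contraNneq kg => <-; apply: codom_f.
- exact: ltnW.
- by move: Nunit; rewrite unitmxE unitfE Ndet intr_eq0.
have : (row k Mq <= rowsub g Mq)%MS by rewrite (eq_maxrowsub Mq) row_sub.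
move=> /submxP[u Du].
have Dw : row k (colsub h Mq) = u *m mxsub g h Mq.
  apply/rowP=> b; have /rowP/(_ (h b)) := Du; rewrite !mxE => ->.
  by apply: eq_bigr => a _; rewrite !mxE.
have Dv : row k (colsub h Mq) *m \adj (mxsub g h Mq) = \det (mxsub g h Mq) *: u.
  by rewrite Dw -mulmxA mul_mx_adj mul_mx_scalar.
move=> j; apply: (intr_inj (R := rat)); rewrite rmorphM /= -Ndet rmorph_sum /=.
have /rowP/(_ j) := Du; rewrite !mxE => ->.
rewrite big_distrr /=; apply: eq_bigr => a _; rewrite rmorphM /= mulrA.
congr (_ * _); last by rewrite !mxE.
have /rowP/(_ a) := Dv; rewrite !mxE => <-.
rewrite rmorph_sum; apply: eq_bigr => b _; rewrite rmorphM /=.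
by rewrite Nadj !mxE.
Qed.

End SmallKernel.

Lemma prod_inj_leq (I J : finType) (g : J -> I) (b : I -> nat) :
  injective g -> (forall i, 0 < b i)%N -> (\prod_j b (g j) <= \prod_i b i)%N.
Proof.
move=> gI b0; rewrite [leqRHS](bigID (mem (codom g))) /= -[leqLHS]muln1.
apply: leq_mul; last by apply: prodn_gt0.
rewrite -(big_imset b (h := g) (A := predT)) /=; last by move=> x y _ _; apply: gI.
apply: eq_leq; apply: eq_bigl => i; apply/imsetP/codomP => [[j _ ->]|[j ->]].
  by exists j.
by exists j.
Qed.

Lemma leq_fact m n : (m <= n)%N -> (m`! <= n`!)%N.
Proof.
move=> /subnK <-; elim: (n - m)%N => // k IH.
by rewrite addSn factS (leq_trans IH) // leq_pmull.
Qed.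

Lemma absz_sum_leq (I : finType) (F : I -> int) (G : I -> nat) :
  (forall i, `|F i| <= G i)%N -> (absz (\sum_i F i)%R <= \sum_i G i)%N.
Proof.
move=> FG; rewrite -lez_nat abszE; apply: le_trans (ler_norm_sum _ _ _) _.
by rewrite -natz natr_sum ler_sum // => i _ /=; rewrite -abszE natz lez_nat.
Qed.

Lemma det_bound_nat n (M : 'M[int]_n) (b : 'I_n -> nat) :
  (forall i j, `|M i j| <= b i)%N -> (`|\det M| <= n`! * \prod_i b i)%N.
Proof.
move=> hM; rewrite -lez_nat abszE.
apply: le_trans (@det_bound _ n M (fun i => (b i)%:Z) _) _.
  by move=> i j; rewrite -abszE lez_nat.
by rewrite PoszM -natz ler_wpM2l // rmorph_prod.
Qed.

Lemma intr_Fp_eq0 p (x : int) : prime p -> (x%:~R == 0 :> 'F_p) = (p %| `|x|)%N.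
Proof. by move=> pp; rewrite -(dvdz_pcharf (pchar_Fp pp)) dvdzE. Qed.

(** Minors smaller than p vanish as soon as they vanish modulo p, so the relation f
    modulo p forces a rank less than s over the rational numbers.  The relation of
    deficient_relation is nonzero modulo p, because its coefficient at row k is a
    nonzero minor and hence is not divisible by p. *)
Lemma small_kernel (p : nat) s n (M : 'M[int]_(s, n)) (b : 'I_s -> nat) (B : nat)
    (f : 'rV['F_p]_s) :
  prime p -> f != 0 -> f *m map_mx intr M = 0 ->
  (forall i j, `|M i j| <= b i)%N -> (forall i, 0 < b i <= B)%N ->
  (s`! * \prod_i b i < p)%N ->
  exists c : 'rV[int]_s,
    [/\ c *m M = 0, exists i, (c ord0 i)%:~R != 0 :> 'F_p &
       forall i, (`|c ord0 i| <= s`! * B ^ s)%N].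
Proof.
move=> pp f0 fM hM hb hp.
have b0 i : (0 < b i)%N by have /andP[] := hb i.
have bB i : (b i <= B)%N by have /andP[] := hb i.
have small_minor r (g : 'I_r -> 'I_s) (h : 'I_r -> 'I_n) : injective g -> (r <= s)%N ->
    (\det (mxsub g h M))%:~R = 0 :> 'F_p -> \det (mxsub g h M) = 0.
  move=> gI rs /eqP d0; apply/eqP; rewrite -absz_eq0; apply: contraTT hp => dn0.
  rewrite -leqNgt; apply: (@leq_trans (`|\det (mxsub g h M)|)).
    apply: dvdn_leq; first by rewrite lt0n.
    by rewrite -intr_Fp_eq0.
  apply: leq_trans (det_bound_nat (b := fun a => b (g a)) _) _.
    by move=> i j; rewrite mxE.
  by apply: leq_mul; [apply: leq_fact | apply: prod_inj_leq].
have B0 : (0 < s)%N -> (0 < B)%N.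
  by move=> s0; apply: leq_trans (bB (Ordinal s0)).
have rs : (\rank (map_mx intr M : 'M[rat]_(s, n)) < s)%N.
  rewrite ltn_neqAle rank_leq_row andbT; apply/negP => fr.
  have [h|c c0 cM] := @kernel_of_minors rat s n (map_mx intr M).
    have -> : colsub h (map_mx intr M) = map_mx intr (mxsub id h M) :> 'M[rat]_s.
      by apply/matrixP=> i j; rewrite !mxE.
    rewrite det_map_mx small_minor //.
    rewrite -det_map_mx; apply/eqP/det0P; exists f => //.
    have -> : map_mx intr (mxsub id h M) = colsub h (map_mx intr M) :> 'M['F_p]_s.
      by apply/matrixP=> i j; rewrite !mxE.
    by rewrite mulmx_colsub fM; apply/matrixP=> i j; rewrite !mxE.
  by move/negP: c0; apply; rewrite -(mulmx_free_eq0 _ fr) cM.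
have [r [g [h [k [gI gk rs' Nn0 rel]]]]] := deficient_relation rs.
set N := mxsub g h M in Nn0 rel; set v := _ *m \adj N in rel.
have k_s : (0 < s)%N by apply: leq_ltn_trans (ltn_ord k).
have bnd_det : (`|\det N| <= s`! * B ^ s)%N.
  apply: leq_trans (det_bound_nat (b := fun=> B) _) _.
    by move=> i j; rewrite mxE (leq_trans (hM _ _)).
  rewrite prod_nat_const card_ord leq_mul ?leq_fact //.
  by rewrite leq_pexp2l ?B0.
have bnd_v a : (`|v ord0 a| <= s`! * B ^ s)%N.
  have r0 : (0 < r)%N by apply: leq_ltn_trans (ltn_ord a).
  have adj_bnd i j : (`|\adj N i j| <= (r.-1)`! * B ^ r.-1)%N.
    rewrite mxE /cofactor abszM; set sg := `|_ ^+ _|%N.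
    have -> : sg = 1%N by rewrite /sg abszX exp1n.
    rewrite mul1n; apply: leq_trans (det_bound_nat (b := fun=> B) _) _.
      by move=> i' j'; rewrite !mxE (leq_trans (hM _ _)).
    by rewrite prod_nat_const card_ord.
  rewrite mxE; apply: (@leq_trans (\sum_(j < r) B * ((r.-1)`! * B ^ r.-1))).
    apply: absz_sum_leq => j; rewrite abszM leq_mul //.
    by rewrite !mxE (leq_trans (hM _ _)).
  rewrite sum_nat_const card_ord.
  have -> : (r * (B * ((r.-1)`! * B ^ r.-1)) = r`! * B ^ r)%N.
    by case: (r) r0 => // r1 _; rewrite factS expnS /=; ring.
  by rewrite leq_mul ?leq_fact // leq_pexp2l ?B0.
(* Row k lies outside the image of g, so the coefficient there is the minor alone. *)
exists (\row_i ((\det N) *+ (i == k) - \sum_(a | g a == i) v 0 a)); split.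
- apply/rowP=> j; rewrite !mxE.
  under eq_bigr => i _ do rewrite mxE mulrBl.
  have pick_k : \sum_i \det N *+ (i == k) * M i j = \det N * M k j.
    rewrite (bigD1 k) //= eqxx mulr1n big1 ?addr0 // => i /negPf->.
    by rewrite mulr0n mul0r.
  rewrite sumrB pick_k rel (partition_big g predT) //= -sumrB big1 // => i _.
  by rewrite big_distrl; apply/eqP; rewrite subr_eq0; apply/eqP/eq_bigr => a /eqP ->.
- exists k; rewrite mxE eqxx big_pred0; last by move=> a; apply: (negPf (gk a)).
  by rewrite subr0 mulr1n; apply: contraNneq Nn0 => z; rewrite small_minor.
move=> i; rewrite mxE; have [->|ik] := eqVneq i k.
  by rewrite big_pred0 ?subr0 // => a; apply: (negPf (gk a)).
rewrite mulr0n sub0r abszN.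
have [/existsP[a /eqP ga]|] := boolP [exists a, g a == i].
  by rewrite (big_pred1 a) // => a'; rewrite -ga; apply: inj_eq.
by rewrite negb_exists => /forallP nga; rewrite big_pred0 // => a; apply: (negPf (nga a)).
Qed.

(** * The determinant method *)

Lemma sum_box_degrees d D :
  (\sum_(x : 'I_d * 'I_D) (x.1 + x.2) = D * 'C(d, 2) + d * 'C(D, 2))%N.
Proof.
rewrite -(pair_big xpredT xpredT (fun (j : 'I_d) (i : 'I_D) => (j + i)%N)) /=.
under eq_bigr => j _ do rewrite big_split /= sum_nat_const card_ord sum_ord_bin.
by rewrite big_split /= -big_distrr /= sum_ord_bin sum_nat_const card_ord.
Qed.

Lemma box_polynomial (k : fieldType) d D (c : 'I_d * 'I_D -> k) :
  exists P : {poly {poly k}}, [/\ (size P <= d)%N, (sizeY P <= D)%N,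
    (exists x, c x != 0) -> P != 0 &
    forall u v, P.[u, v] = \sum_x c x * (u ^+ x.1 * v ^+ x.2)].
Proof.
pose e (j i : nat) := \sum_(x : 'I_d * 'I_D | ((x.1 : nat) == j) && ((x.2 : nat) == i)) c x.
have eE (j : 'I_d) (i : 'I_D) : e j i = c (j, i).
  by rewrite /e (big_pred1 (j, i)).
exists (\poly_(j < d) \poly_(i < D) e j i); split.
- exact: size_poly.
- apply/bigmax_leqP => i _; rewrite coef_poly; case: ifP => _; last by rewrite size_poly0.
  exact: size_poly.
- move=> [[j i] cji]; apply: contraNneq cji => P0.
  have := congr1 (fun P : {poly {poly k}} => P`_j`_i) P0.
  by rewrite !coef_poly ltn_ord coef_poly ltn_ord eE !coef0 => ->.
move=> u v; rewrite horner_poly horner_sum.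
transitivity (\sum_(x : 'I_d * 'I_D) c (x.1, x.2) * (u ^+ x.1 * v ^+ x.2)); last first.
  by apply: eq_bigr => -[].
rewrite -(pair_big xpredT xpredT (fun j i => c (j, i) * (u ^+ j * v ^+ i))) /=.
apply: eq_bigr => j _; rewrite -polyC_exp hornerM hornerC horner_poly big_distrl.
by apply: eq_bigr => i _; rewrite eE /= -mulrA [v ^+ i * _]mulrC.
Qed.

Section DeterminantMethod.

Variables (p : nat) (K : closedFieldType) (iota : {rmorphism 'F_p -> K}).
Variables (Fs : {poly {poly 'F_p}}) (d D : nat) (lc : 'F_p).
Variables (T : finType) (U V : T -> int).

Hypotheses (Firr : irreducible_elt (map_poly (map_poly iota) Fs))
  (szF : size Fs = d.+1) (lcF : Fs`_d = lc%:P) (szYF : (sizeY Fs <= d.+1)%N).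

Definition residue_point (t : T) : 'F_p * 'F_p := ((U t)%:~R, (V t)%:~R).

Lemma common_points_leq m (P : {poly {poly 'F_p}}) (C : {set T}) :
  {in C &, injective residue_point} ->
  P != 0 -> (size P <= d)%N -> (sizeY P <= m.+1)%N -> (d <= m)%N ->
  (forall t, t \in C -> Fs.[(U t)%:~R, (V t)%:~R] = 0) ->
  (forall t, t \in C -> P.[(U t)%:~R, (V t)%:~R] = 0) ->
  (#|C| <= 2 * d * m * d)%N.
Proof.
move=> Cinj P0 szP szYP dm FC PC.
apply: leq_trans (common_zeros_leq Firr szF lcF P0 szP (leq_trans szYF _) szYP) => //.
rewrite -(card_in_imset Cinj); apply: subset_leq_card.
by apply/subsetP => _ /imsetP[t tC ->]; rewrite inE /= FC // PC // eqxx.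
Qed.

(** Every determinant of the dD monomials at points of C is divisible by a power of
    q larger than its size, so it vanishes.  The monomials are then linearly
    dependent on C modulo p, and the resulting polynomial has degree less than d in
    the main variable, so Bezout's bound applies to it and Fs. *)
Lemma class_leq (G : {poly {poly int}}) (B q a : nat) (C : {set T}) :
  {in C &, injective residue_point} ->
  (forall t, t \in C -> Fs.[(U t)%:~R, (V t)%:~R] = 0) ->
  (forall t, t \in C -> G.[U t, V t] = 0) ->
  (forall t, t \in C -> (`|U t| <= B) && (`|V t| <= B))%N ->
  prime q -> (0 < a)%N ->
  (forall t, t \in C -> ~~ (q %| G^`().[U t, V t])%Z) ->
  {in C &, forall s t, (q %| U s - U t)%Z /\ (q%:Z ^+ a %| V s - V t)%Z} ->
  ((d * D)`! * B ^ (D * 'C(d, 2) + d * 'C(D, 2)) < q ^ (a * 'C(d * D, 2)))%N ->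
  (#|C| <= 2 * d * (d + D) * d)%N.
Proof.
move=> Cinj FC GC BC qp a0 AC sameC small.
have [->|[t0 t0C]] := set_0Vmem C; first by rewrite cards0.
have cI : #|{: 'I_d * 'I_D}| = (d * D)%N by rewrite card_prod !card_ord.
move: small; rewrite -cI => small.
(* The derivative is the same unit modulo q along the class; w' is its inverse. *)
have /coprimezP[[w w'] /= Dw] : coprimez q (G^`().[U t0, V t0]).
  rewrite coprimezE prime_coprime //; exact: AC.
have hw t : t \in C -> (q %| w' * G^`().[U t, V t] - 1)%Z.
  move=> tC; have [hU hV] := sameC t t0 tC t0C.
  have -> : w' * G^`().[U t, V t] - 1 =
    w' * (G^`().[U t, V t] - G^`().[U t0, V t0]) - w * q by rewrite -Dw; ring.
  rewrite rpredB ?dvdz_mull //.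
  rewrite -[G^`().[_, _]](subrK (G^`().[U t, V t0])) -addrA; apply: rpredD.
    by apply: dvdz_horner_sub; apply: dvdz_trans hV; rewrite -[X in (X %| _)%Z]expr1 dvdz_exp2l.
  by rewrite !horner_eval2; apply: dvdz_horner_sub.
pose M (x : 'I_d * 'I_D) (t : T) : 'F_p := (U t)%:~R ^+ x.1 * (V t)%:~R ^+ x.2.
have [f fC|c c0 cM] := @kernel_of_minors_on 'F_p _ T C M.
  pose mon (i : 'I_#|{: 'I_d * 'I_D}|) : {poly {poly int}} :=
    'X ^+ (enum_val i).1 * 'Y ^+ (enum_val i).2.
  pose Mz := \matrix_(i, j) (mon i).[U (f j), V (f j)].
  have MzE i j : Mz i j = U (f j) ^+ (enum_val i).1 * V (f j) ^+ (enum_val i).2.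
    rewrite mxE hornerM !horner_exp hornerX hornerC -polyC_exp hornerM hornerC.
    by rewrite horner_exp hornerX.
  suff Mz0 : \det Mz = 0.
    transitivity ((\det Mz)%:~R : 'F_p); last by rewrite Mz0.
    rewrite -det_map_mx; congr (\det _); apply/matrixP=> i j.
    by rewrite [RHS]mxE MzE mxE rmorphM !rmorphXn.
  have dvd : (q%:Z ^+ (a * 'C(#|{: 'I_d * 'I_D}|, 2)) %| \det Mz)%Z.
    apply: (@det_branch_dvd G q w' (U t0)) => [i|i|i|i j].
    - exact: GC.
    - by have [] := sameC _ _ (fC i) t0C.
    - exact: hw.
    - by have [] := sameC _ _ (fC i) (fC j).
  apply/eqP; rewrite -absz_eq0; apply: contraTT small => dn0.
  rewrite -leqNgt; apply: (@leq_trans `|\det Mz|%N).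
    by move: dvd; rewrite dvdzE abszX /=; apply: dvdn_leq; rewrite lt0n.
  pose b (i : 'I_#|{: 'I_d * 'I_D}|) := (B ^ ((enum_val i).1 + (enum_val i).2))%N.
  have Mb i j : (`|Mz i j| <= b i)%N.
    rewrite MzE abszM !abszX /b expnD.
    have /andP[hU hV] := BC _ (fC j).
    by apply: leq_mul; [case: (val (enum_val i).1) | case: (val (enum_val i).2)] => // n;
      rewrite leq_exp2r.
  apply: leq_trans (det_bound_nat Mb) _.
  rewrite /b -expn_sum leq_mul2l; apply/orP; right.
  rewrite -sum_box_degrees [in leqRHS](reindex (enum_val : 'I_#|{: 'I_d * 'I_D}| -> _)) //=.
  exact/onW_bij/enum_val_bij.
have [P [szP szYP P0 PE]] := box_polynomial c.
apply: (common_points_leq (P := P)) => //.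
- exact: P0.
- by apply: leq_trans szYP _; rewrite leqW // leq_addl.
- exact: leq_addr.
- by move=> t tC; rewrite PE; apply: cM.
Qed.

(** Fixing v modulo q^a but u only modulo q is enough by Hensel's lemma, and gives
    q^(a + 1) classes instead of q^(2 a). *)
Lemma residue_classes_leq (G : {poly {poly int}}) (B q a : nat) (S : {set T}) :
  {in S &, injective residue_point} ->
  (forall t, t \in S -> Fs.[(U t)%:~R, (V t)%:~R] = 0) ->
  (forall t, t \in S -> G.[U t, V t] = 0) ->
  (forall t, t \in S -> (`|U t| <= B) && (`|V t| <= B))%N ->
  prime q -> (0 < a)%N ->
  (forall t, t \in S -> ~~ (q %| G^`().[U t, V t])%Z) ->
  ((d * D)`! * B ^ (D * 'C(d, 2) + d * 'C(D, 2)) < q ^ (a * 'C(d * D, 2)))%N ->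
  (#|S| <= q ^ a.+1 * (2 * d * (d + D) * d))%N.
Proof.
move=> Sinj FS GS BS qp a0 AS small; have q0 := prime_gt0 qp.
have res_lt n (x : int) : (0 < n)%N -> (`|(x %% n%:Z)%Z| < n)%N.
  move=> n0; have nz : n%:Z != 0 by rewrite -lt0n.
  by rewrite -ltz_nat gez0_abs ?modz_ge0 // ltz_mod.
have res_eq n (x y : int) : (0 < n)%N -> `|(x %% n%:Z)%Z|%N = `|(y %% n%:Z)%Z|%N -> (n %| x - y)%Z.
  move=> n0; have nz : n%:Z != 0 by rewrite -lt0n.
  move=> /(congr1 Posz); rewrite !gez0_abs ?modz_ge0 // => E.
  by rewrite -eqz_mod_dvd; apply/eqP.
have qa0 : (0 < q ^ a)%N by rewrite expn_gt0 q0.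
pose cls t : 'I_q * 'I_(q ^ a) :=
  (Ordinal (res_lt q (U t) q0), Ordinal (res_lt (q ^ a)%N (V t) qa0)).
have -> : (q ^ a.+1 = #|[set: 'I_q * 'I_(q ^ a)]|)%N.
  by rewrite cardsT card_prod !card_ord expnS.
apply: (card_fiberwise (f := cls)) => [t _|b _]; first by rewrite inE.
apply: (@class_leq G B q a) => //.
- by move=> s t; rewrite !inE => /andP[sS _] /andP[tS _]; apply: Sinj.
- by move=> t; rewrite !inE => /andP[tS _]; apply: FS.
- by move=> t; rewrite !inE => /andP[tS _]; apply: GS.
- by move=> t; rewrite !inE => /andP[tS _]; apply: BS.
- by move=> t; rewrite !inE => /andP[tS _]; apply: AS.
move=> s t; rewrite !inE => /andP[_ /eqP <-] /andP[_ /eqP [hU hV]].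
split; first by apply: res_eq.
by rewrite -(natz q) -natrX natz; apply: res_eq.
Qed.

End DeterminantMethod.

(** * Small primes not dividing an integer *)

Lemma expn2_leq_central_bin n : (2 ^ n <= 'C(n.*2, n))%N.
Proof.
elim: n => // n IH; rewrite doubleS expnS binS mul2n -addnn.
apply: leq_add; first by rewrite binS (leq_trans IH) // leq_addl.
by apply: (leq_trans IH); case: {IH} n => // n; rewrite [leqRHS]binS leq_addr.
Qed.

Lemma divn_double_leq n m : (0 < m)%N ->
  (n.*2 %/ m <= n %/ m + n %/ m + (m <= n.*2))%N.
Proof.
move=> m0; have [h|h] := leqP m n.*2; last by rewrite divn_small.
by rewrite addn1 -ltnS ltn_divLR //; have := divn_eq n m; have := ltn_pmod n m0; nia.
Qed.

(** By Legendre's formula the valuation is a sum over k of terms 0 or 1, and only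
    the k with p^k <= 2n contribute. *)
Lemma logn_central_bin p n : prime p -> (0 < n)%N ->
  (logn p 'C(n.*2, n) <= trunc_log p n.*2)%N.
Proof.
move=> pp n0; have p1 := prime_gt1 pp; have p0 := prime_gt0 pp.
have E : (logn p 'C(n.*2, n) + (logn p n`! + logn p n`!) = logn p (n.*2)`!)%N.
  rewrite -(bin_fact (m := n) (n := n.*2)); last by rewrite -addnn leq_addr.
  rewrite -addnn addnK !lognM ?muln_gt0 ?fact_gt0 //.
  by rewrite bin_gt0 leq_addr.
have wide : logn p n`! = (\sum_(1 <= k < n.*2.+1) n %/ p ^ k)%N.
  rewrite logn_fact // [RHS](big_cat_nat (n := n.+1)) //=; last by rewrite ltnS -addnn leq_addr.
  rewrite [X in (_ + X)%N]big_nat_cond [X in (_ + X)%N]big1 ?addn0 // => k /andP[/andP[nk _] _].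
  by rewrite divn_small // (leq_trans nk) // ltnW // ltn_expl.
have cnt : (\sum_(1 <= k < n.*2.+1) (p ^ k <= n.*2) <= trunc_log p n.*2)%N.
  have tn : (trunc_log p n.*2 <= n.*2)%N.
    rewrite -ltnS; apply: (@leq_trans (p ^ trunc_log p n.*2).+1).
      by rewrite ltnS ltnW // ltn_expl.
    by rewrite ltnS trunc_logP // double_gt0.
  rewrite (big_cat_nat (n := (trunc_log p n.*2).+1)) //=.
  rewrite [X in (_ + X)%N]big_nat_cond [X in (_ + X)%N]big1 ?addn0; last first.
    move=> k /andP[/andP[tk _] _]; apply/eqP; rewrite eqb0 -ltnNge.
    apply: leq_trans (trunc_log_ltn n.*2 p1) _; by rewrite leq_exp2l.
  apply: (@leq_trans (\sum_(1 <= k < (trunc_log p n.*2).+1) 1)%N).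
    by apply: leq_sum => k _; exact: leq_b1.
  by rewrite sum_nat_const_nat muln1 subn1.
move: E; rewrite [logn p (n.*2)`!]logn_fact // wide => E.
have : (logn p 'C(n.*2, n) +
    (\sum_(1 <= k < n.*2.+1) n %/ p ^ k + \sum_(1 <= k < n.*2.+1) n %/ p ^ k) <=
  trunc_log p n.*2 +
    (\sum_(1 <= k < n.*2.+1) n %/ p ^ k + \sum_(1 <= k < n.*2.+1) n %/ p ^ k))%N.
  rewrite E addnC; apply: leq_trans (leq_add (leqnn _) cnt).
  rewrite -!big_split /=; apply: leq_sum => k _.
  by apply: divn_double_leq; rewrite expn_gt0 p0.
by rewrite leq_add2r.
Qed.

(** If all primes up to 2n divided A, then by logn_central_bin the central binomial
    coefficient, which is at least 2^n, would divide A ^ trunc_log 2 (2n). *)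
Lemma exists_prime_not_dvd n A : (0 < n)%N -> (0 < A)%N ->
  (A ^ trunc_log 2 n.*2 < 2 ^ n)%N ->
  exists q, [/\ prime q, (q <= n.*2)%N & ~~ (q %| A)%N].
Proof.
move=> n0 A0 hA; pose t := trunc_log 2 n.*2.
have : ~~ ('C(n.*2, n) %| A ^ t)%N.
  apply: contraL hA => /dvdn_leq; rewrite expn_gt0 A0 => /(_ isT) h.
  by rewrite -leqNgt (leq_trans (expn2_leq_central_bin n)).
have C0 : (0 < 'C(n.*2, n))%N by rewrite bin_gt0 -addnn leq_addr.
move=> nd; have [h|] := boolP [exists q : 'I_n.*2.+1, prime q && ~~ (q %| A)%N].
  by have /existsP[q /andP[pq qA]] := h; exists q; split; rewrite // -ltnS.
rewrite negb_exists => /forallP all_dvd; case/negP: nd.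
apply/dvdn_partP => // q; rewrite mem_primes => /and3P[qp _ qC].
rewrite p_part pfactor_dvdn // ?expn_gt0 ?A0 //.
have lt := logn_central_bin qp n0.
have l0 : (0 < logn q 'C(n.*2, n))%N by rewrite logn_gt0 mem_primes qp C0.
have q1 := prime_gt1 qp.
have m0 : (0 < n.*2)%N by rewrite double_gt0.
have qn : (q <= n.*2)%N.
  rewrite -{1}[q]expn1 (leq_trans _ (trunc_logP q1 m0)) // leq_exp2l //.
  exact: leq_trans lt.
have qA : (q %| A)%N.
  have := all_dvd (Ordinal (qn : (q < n.*2.+1)%N)).
  by rewrite qp negbK.
rewrite lognX; apply: (leq_trans lt); apply: (@leq_trans t).
  apply: trunc_log_max => //; apply: leq_trans (trunc_logP q1 m0).
  by rewrite leq_exp2r // (leq_trans l0).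
by rewrite leq_pmulr // logn_gt0 mem_primes qp A0.
Qed.

(** * The Newton diagram of F *)

(** The set whose cardinality is delta F. *)
Definition divisor_exponents (R : nzRingType) (F : {poly {poly R}}) :=
  [set kl : 'I_(size F) * 'I_(sizeY F) |
     [exists ij in exponents F, (kl.1 <= ij.1)%N && (kl.2 <= ij.2)%N]].

Lemma coef_exponent (R : nzRingType) (F : {poly {poly R}}) i j : F`_i`_j != 0 ->
  exists2 ij, ij \in exponents F & (ij.1 = i :> nat) /\ (ij.2 = j :> nat).
Proof.
move=> Fij; have iF : (i < size F)%N.
  by rewrite ltnNge; apply: contra Fij => h; rewrite [F`_i]nth_default // coef0.
have jF : (j < sizeY F)%N.
  apply: leq_trans (max_size_coefXY F i).
  by rewrite ltnNge; apply: contra Fij => h; rewrite nth_default.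
by exists (Ordinal iF, Ordinal jF); rewrite ?inE.
Qed.

Lemma exponent_degree (R : nzRingType) (F : {poly {poly R}}) ij :
  ij \in exponents F -> (ij.1 + ij.2 <= total_degree F)%N.
Proof.
move=> ijF.
exact: (@leq_bigmax_cond _ (mem (exponents F)) (fun ij => ij.1 + ij.2)%N ij ijF).
Qed.

Lemma total_degree_tdeg (R : comNzRingType) (F : {poly {poly R}}) : tdeg_le (total_degree F) F.
Proof.
move=> i j; rewrite ltnNge => h; apply/eqP; apply: contraNT h => Fij.
have [ij ijF [<- <-]] := coef_exponent Fij.
exact: exponent_degree.
Qed.

Lemma total_degree_attained (R : nzRingType) (F : {poly {poly R}}) : F != 0 ->
  exists i j, (i + j)%N = total_degree F /\ F`_i`_j != 0.
Proof.
move=> F0; have [ij0 ij0F _] : exists2 ij, ij \in exponents F & (ij.1 = (size F).-1 :> nat) /\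
    (ij.2 = (size (lead_coef F)).-1 :> nat).
  by apply: coef_exponent; rewrite -lead_coefE -lead_coefE !lead_coef_eq0.
have E0 : (0 < #|exponents F|)%N by apply/card_gt0P; exists ij0.
have [ij ijF E] := eq_bigmax_cond (fun ij : 'I_(size F) * 'I_(sizeY F) => ij.1 + ij.2)%N E0.
by exists ij.1, ij.2; split; [rewrite /total_degree E | move: ijF; rewrite inE].
Qed.

Lemma divisor_exponent_degree (R : comNzRingType) (F : {poly {poly R}}) kl :
  kl \in divisor_exponents F -> (kl.1 + kl.2 <= total_degree F)%N.
Proof.
rewrite inE => /exists_inP[ij ijF /andP[h1 h2]].
by apply: leq_trans (leq_add h1 h2) _; apply: exponent_degree.
Qed.

Lemma delta_leq (R : comNzRingType) (F : {poly {poly R}}) :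
  (delta F <= (total_degree F).+1 ^ 2)%N.
Proof.
apply: leq_trans (max_card _) _; rewrite card_prod !card_ord expnS expn1.
have h := @total_degree_tdeg _ F.
by apply: leq_mul; [apply: tdeg_le_size | apply: tdeg_le_sizeY].
Qed.

(** The sum bounds the exponent of H in a minor of order delta F.  In the comparison
    of each degree with d - 1/2, the exponents of degree d lose 1/2 and those of
    degree d - 1 gain 1/2.  There is at most one more of the former than of the
    latter, since (k, l) -> (k - 1, l) maps those with k > 0 injectively; the
    exponent (0, 0) compensates for the remaining one and leaves a margin. *)
Lemma sum_divisor_degrees (R : comNzRingType) (F : {poly {poly R}}) d :
  F != 0 -> total_degree F = d -> (2 <= d)%N ->
  (2 * \sum_(kl in divisor_exponents F) (kl.1 + kl.2) + 2 + delta F <= 2 * d * delta F)%N.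
Proof.
move=> F0 dF d2; rewrite /delta -/(divisor_exponents F); set Dl := divisor_exponents F.
have Ddeg kl : kl \in Dl -> (kl.1 + kl.2 <= d)%N by rewrite -dF; apply: divisor_exponent_degree.
have Ddown kl k' l' : kl \in Dl -> (k' <= kl.1)%N -> (l' <= kl.2)%N ->
   exists2 kl', kl' \in Dl & (kl'.1 = k' :> nat) /\ (kl'.2 = l' :> nat).
  move=> klD kk ll.
  exists (Ordinal (leq_ltn_trans kk (ltn_ord _)),
          Ordinal (leq_ltn_trans ll (ltn_ord _))) => //.
  move: klD; rewrite !inE => /exists_inP[ij ijF /andP[h1 h2]].
  by apply/exists_inP; exists ij => //=; rewrite (leq_trans kk) // (leq_trans ll).
pose N e := #|[set kl in Dl | (kl.1 + kl.2 == e)%N]|.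
have [z zD [z1 z2]] : exists2 z, z \in Dl & (z.1 = 0 :> nat)%N /\ (z.2 = 0 :> nat)%N.
  have [i [j [_ Fij]]] := total_degree_attained F0.
  have [ij ijF _] := coef_exponent Fij.
  apply: (Ddown ij) => //; rewrite inE; apply/exists_inP; exists ij => //.
  by rewrite !leqnn.
have Nd : (N d <= N d.-1 + 1)%N.
  pose A b := [set kl in Dl | (kl.1 + kl.2 == d)%N && ((0 < kl.1)%N == b)].
  have -> : N d = (#|A true| + #|A false|)%N.
    rewrite /N -(cardsID [set kl : 'I_(size F) * 'I_(sizeY F) | (0 < kl.1)%N]); congr (_ + _)%N.
      by apply: eq_card => kl; rewrite !inE -andbA; case: (0 < _)%N.
    apply: eq_card => kl; rewrite !inE; case: (0 < _)%N; by rewrite ?andbF ?andbT.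
  apply: leq_add.
    pose pr (kl : 'I_(size F) * 'I_(sizeY F)) : 'I_(size F) * 'I_(sizeY F) :=
      (Ordinal (leq_ltn_trans (leq_pred _) (ltn_ord kl.1)), kl.2).
    rewrite -(card_in_imset (f := pr)).
      apply: subset_leq_card; apply/subsetP => _ /imsetP[kl klA ->].
      move: klA; rewrite !inE /= => /andP[/exists_inP[ij ijF /andP[h1 h2]] /andP[/eqP kd /eqP k0]].
      apply/andP; split; last by rewrite -kd -(prednK k0).
      by apply/exists_inP; exists ij => //=; rewrite h2 (leq_trans (leq_pred _)).
    move=> [[k hk] l] [[k' hk'] l']; rewrite !inE /=.
    move=> /andP[_ /andP[_ /eqP k0]] /andP[_ /andP[_ /eqP k0']].
    move=> [E ->]; congr (_, _); apply: val_inj => /=.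
    by rewrite -(prednK k0) E prednK.
  apply/card_le1_eqP => -[k l] [k' l']; rewrite !inE /=.
  rewrite !eqbF_neg -!leqNgt !leqn0.
  move=> /andP[_ /andP[/eqP h /eqP k0]] /andP[_ /andP[/eqP h' /eqP k0']].
  by congr (_, _); apply: val_inj => /=; lia.
(* Degree 0 has slack at least 3 because d >= 2. *)
have pointwise : (\sum_(kl in Dl) (2 * (kl.1 + kl.2) + 1 + (kl.1 + kl.2 == d.-1) + 3 * (kl == z)) <=
    \sum_(kl in Dl) (2 * d + (kl.1 + kl.2 == d)))%N.
  apply: leq_sum => kl klD; have := Ddeg _ klD.
  have [->|klz] := eqVneq kl z; first by rewrite z1 z2; case: eqP; lia.
  by rewrite muln0 addn0; case: eqP; case: eqP; lia.
have cnt (Q : pred ('I_(size F) * 'I_(sizeY F))) :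
    (\sum_(kl in Dl) (Q kl : nat) = #|[set kl in Dl | Q kl]|)%N.
  rewrite -sum1dep_card big_mkcondr; apply: eq_bigr => kl _; by case: (Q kl).
have := cnt (fun kl => kl.1 + kl.2 == d)%N; have := cnt (fun kl => kl.1 + kl.2 == d.-1)%N.
rewrite /= -/(N d) -/(N d.-1) => c1 c2.
have := cnt (pred1 z); rewrite /= => c3.
move: pointwise; rewrite !big_split /= c1 c2.
rewrite c3 !sum_nat_const.
have -> : #|[set kl in Dl | kl == z]| = 1%N.
  rewrite (_ : [set _ in _ | _] = [set z]) ?cards1 //.
  by apply/setP => kl; rewrite !inE andbC; case: eqP => // ->; move: zD; rewrite inE.
move: Nd; rewrite muln1 !muln0.
set S1 := (\sum_(kl in Dl) kl.1)%N; set S2 := (\sum_(kl in Dl) kl.2)%N.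
rewrite -mulnA [(d * _)%N]mulnC.
move: (#|Dl| * d)%N (N d) (N d.-1) #|Dl| S1 S2 => a n n1 e s1 s2; clear; lia.
Qed.

(** Translating X^i Y^j produces only monomials that divide it. *)
Lemma linear_change0_support (R : comNzRingType) (F : {poly {poly R}}) K L k l :
  (linear_change 0 K L F)`_l`_k != 0 ->
  exists2 kl, kl \in divisor_exponents F & (kl.1 = k :> nat) /\ (kl.2 = l :> nat).
Proof.
move=> nz.
have [i [j [Fij ki lj]]] : exists i j, [/\ F`_i`_j != 0, (k <= i)%N & (l <= j)%N].
  have [/existsP[i /existsP[j /and3P[h1 h2 h3]]]|none] :=
    boolP [exists i : 'I_(size F), [exists j : 'I_(sizeY F),
      [&& F`_i`_j != 0, (k <= i)%N & (l <= j)%N]]]; first by exists i, j.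
  case/eqP: nz; rewrite linear_change_expand !coef_sum big1 // => i _.
  rewrite !coef_sum big1 // => j _.
  have szX (a : R) n : size (('X + a%:P) ^+ n) = n.+1.
    by rewrite -[a]opprK polyCN size_exp_XsubC.
  have term : ((F`_i`_j)%:P%:P * ('X%:P + K%:P%:P + 0%:P *: 'X) ^+ i * ('X + L%:P%:P) ^+ j)`_l`_k =
     F`_i`_j * (('X + K%:P) ^+ i)`_k * (('X + L%:P) ^+ j)`_l.
    rewrite scale0r addr0 -polyCD -polyC_exp -polyCM.
    have -> : 'X + L%:P%:P = ('X + L%:P)^:P by rewrite rmorphD /= map_polyX map_polyC.
    by rewrite -rmorphXn /= coefCM coef_map /= coefMC coefCM.
  rewrite term; have [/eqP->|Fij] := boolP (F`_i`_j == 0); first by rewrite !mul0r.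
  have [ki|ki] := leqP k i; last first.
    rewrite [X in _ * X * _]nth_default ?mulr0 ?mul0r //.
    by rewrite szX.
  have [lj|lj] := leqP l j; last by rewrite [X in _ * X]nth_default ?mulr0 // szX.
  by case/negP: none; apply/existsP; exists i; apply/existsP; exists j; rewrite Fij ki lj.
have [ij ijF [E1 E2]] := coef_exponent Fij; subst.
exists (Ordinal (leq_ltn_trans ki (ltn_ord _)), Ordinal (leq_ltn_trans lj (ltn_ord _))) => //.
by rewrite inE; apply/exists_inP; exists ij => //=; rewrite ki lj.
Qed.

Lemma translated_horner (R : comNzRingType) (F : {poly {poly R}}) K L x y :
  F.[x + K, y + L] = \sum_(kl in divisor_exponents F)
    (linear_change 0 K L F)`_(kl.2)`_(kl.1) * (x ^+ kl.1 * y ^+ kl.2).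
Proof.
have := linear_change_horner 0 K L F y x; rewrite mul0r addr0 => <-.
set P := linear_change 0 K L F.
have supp l k : (sizeY F <= l)%N || (size F <= k)%N -> P`_l`_k = 0.
  move=> h; apply/eqP; apply: contraTT h => /linear_change0_support[kl _ [<- <-]].
  by rewrite negb_or -!ltnNge !ltn_ord.
rewrite (@horner2_wide _ _ (sizeY F) (size F)); last 2 first.
- by apply/leq_sizeP => l h; apply/polyP => k; rewrite coef0 supp // h.
- by apply/bigmax_leqP => l _; apply/leq_sizeP => k h; rewrite supp // h orbT.
rewrite exchange_big (pair_big xpredT xpredT) /= [RHS]big_mkcond.
apply: eq_bigr => -[k l] _ /=; case: ifP => [_|/negbT nD]; first by rewrite [y ^+ _ * _]mulrC.
have [->|/linear_change0_support[kl klD [h1 h2]]] := eqVneq (P`_l`_k) 0; first by rewrite mul0r.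
case/negP: nD; suff -> : (k, l) = kl by [].
by case: kl h1 h2 {klD} => k' l' /= h1 h2; congr (_, _); apply: val_inj.
Qed.

(** The coefficient computed in linear_change_top is a nonzero polynomial of degree
    at most d in t, and 0, ..., d are distinct modulo p. *)
Lemma good_shear p (F : {poly {poly 'F_p}}) d :
  prime p -> (d < p)%N -> F != 0 -> total_degree F = d ->
  exists2 t, (t <= d)%N & \sum_(i < d.+1) F`_i`_(d - i) * (t%:R : 'F_p) ^+ i != 0.
Proof.
move=> pp dp F0 dF; pose T : {poly 'F_p} := \poly_(i < d.+1) F`_i`_(d - i).
have T0 : T != 0.
  have [i [j [ij Fij]]] := total_degree_attained F0.
  apply: contraNneq Fij => /(congr1 (fun q : {poly 'F_p} => q`_i)).
  rewrite coef_poly coef0 ltnS -dF -ij leq_addr addKn => ->; exact: eqxx.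
have [/allP all0|] := boolP (all (root T) [seq t%:R | t <- iota 0 d.+1]); last first.
  move/allPn => [_ /mapP[t + ->]]; rewrite mem_iota /= add0n ltnS => td.
  by rewrite /root horner_poly => h; exists t.
have : (size [seq (t%:R : 'F_p) | t <- iota 0 d.+1] < size T)%N.
  apply: max_poly_roots => //; first exact/allP.
  rewrite map_inj_in_uniq ?iota_uniq // => a b; rewrite !mem_iota /= !add0n => ha hb.
  move=> /(congr1 val); rewrite /= !val_Fp_nat // !modn_small //.
  - exact: leq_trans hb _.
  exact: leq_trans ha _.
by rewrite size_map size_iota ltnNge size_poly.
Qed.

(** * Sums of monomials *)

Section MonomialSum.

Variables (I : finType) (e1 e2 : I -> nat).

Definition monomial_sum (R : comNzRingType) (c : I -> R) : {poly {poly R}} :=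
  \sum_i (c i)%:P%:P * 'X ^+ (e1 i) * 'Y ^+ (e2 i).

Lemma monomial_sum_horner (R : comNzRingType) (c : I -> R) u v :
  (monomial_sum c).[u, v] = \sum_i c i * (u ^+ e1 i * v ^+ e2 i).
Proof.
rewrite /monomial_sum !horner_sum; apply: eq_bigr => i _.
by rewrite !(hornerM, horner_exp, hornerC, hornerX) -mulrA.
Qed.

Lemma monomial_sum_map (R S : comNzRingType) (f : {rmorphism R -> S}) (c : I -> R) :
  map_poly (map_poly f) (monomial_sum c) = monomial_sum (fun i => f (c i)).
Proof.
rewrite /monomial_sum rmorph_sum; apply: eq_bigr => i _ /=.
by rewrite !rmorphM /= !rmorphXn /= !map_polyC /= map_polyC map_polyX /= map_polyX.
Qed.

Lemma monomial_sum_tdeg (R : comNzRingType) (c : I -> R) d :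
  (forall i, e1 i + e2 i <= d)%N -> tdeg_le d (monomial_sum c).
Proof.
move=> ed; apply: tdeg_le_sum => i _; apply: tdeg_leW (ed i) _.
apply: tdeg_leM; last exact/tdeg_le_pow/tdeg_leY1.
by apply: (@tdeg_leM _ 0); [apply: tdeg_leC | exact/tdeg_le_pow/tdeg_leX1].
Qed.

Lemma coef_monomialXY (R : comNzRingType) (c : R) a b m n :
  (c%:P%:P * 'X ^+ a * 'Y ^+ b)`_m`_n = c *+ ((m == a) && (n == b)).
Proof.
rewrite -polyC_exp coefMC [_`_m]coefCM coefXn.
case: (m == a); last by rewrite mulr0 mul0r coef0.
by rewrite mulr1 coefCM coefXn; case: (n == b); rewrite ?mulr1 ?mulr0.
Qed.

Lemma monomial_sum_neq0 (R : comNzRingType) (c : I -> R) i :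
  injective (fun i => (e1 i, e2 i)) -> c i != 0 -> monomial_sum c != 0.
Proof.
move=> eI; apply: contraNneq => /(congr1 (fun P : {poly {poly R}} => P`_(e1 i)`_(e2 i))).
rewrite !coef0 !coef_sum (bigD1 i) //= big1 ?addr0 => [|j ji].
  by rewrite coef_monomialXY !eqxx mulr1n => ->.
rewrite coef_monomialXY; case: andP => [[/eqP h1 /eqP h2]|_] //.
by case/eqP: ji; apply: eI; rewrite h1 h2.
Qed.

Lemma deriv_monomial_term (R : comNzRingType) (c : R) (A B : {poly R}) a b :
  (c%:P * A ^+ a * B ^+ b)^`() =
  c%:P * (A^`() * A ^+ a.-1 * B ^+ b *+ a + B^`() * A ^+ a * B ^+ b.-1 *+ b).
Proof.
rewrite -mulrA derivM derivC mul0r add0r derivM !deriv_exp; congr (_ * (_ + _)).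
  by rewrite mulrnAl.
by rewrite mulrnAr mulrCA mulrA.
Qed.

Lemma deriv_monomial_horner (R : comNzRingType) (c s : R) (A B : {poly {poly R}}) a b u v :
  A^`() = s%:P%:P -> B^`() = 1 ->
  (c%:P%:P * A ^+ a * B ^+ b)^`().[u, v] =
  c * (s * A.[u, v] ^+ a.-1 * B.[u, v] ^+ b *+ a + A.[u, v] ^+ a * B.[u, v] ^+ b.-1 *+ b).
Proof.
move=> dA dB; rewrite deriv_monomial_term dA dB mul1r.
by rewrite !(hornerM, hornerC, hornerD, hornerMn, horner_exp).
Qed.

Lemma shear_deriv_horner (R : comNzRingType) (c : I -> R) (t u x : R) :
  (linear_change t 0 0 (monomial_sum c))^`().[u, x - t * u] =
  \sum_i c i * (t * x ^+ (e1 i).-1 * u ^+ e2 i *+ e1 i + x ^+ e1 i * u ^+ (e2 i).-1 *+ e2 i).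
Proof.
set A := 'X%:P + (0 : R)%:P%:P + t%:P *: 'X.
set B := 'X + (0 : R)%:P%:P.
have -> : linear_change t 0 0 (monomial_sum c) =
    \sum_i (c i)%:P%:P * A ^+ (e1 i) * B ^+ (e2 i).
  rewrite /monomial_sum rmorph_sum; apply: eq_bigr => i _.
  by rewrite !rmorphM /= !rmorphXn /= linear_change_C linear_change_X linear_change_Y.
have dA : A^`() = t%:P%:P.
  by rewrite /A !derivD !derivC !add0r derivZ derivX alg_polyC.
have dB : B^`() = 1 by rewrite /B derivD derivC derivX addr0.
have Ae : A.[u, x - t * u] = x.
  by rewrite /A !(hornerD, hornerC, hornerZ, hornerX, hornerM); ring.
have Be : B.[u, x - t * u] = u.
  by rewrite /B !(hornerD, hornerC, hornerX); ring.
clearbody A B; rewrite raddf_sum !horner_sum; apply: eq_bigr => i _ /=.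
by rewrite (deriv_monomial_horner _ _ _ _ _ dA dB) Ae Be.
Qed.

(** The size of the derivative of a sheared polynomial is seen in the original
    coordinates, where x and u both lie in [0, H]. *)
Lemma shear_deriv_bound (c : I -> int) (d H t C : nat) (u x : int) :
  (forall i, e1 i + e2 i <= d)%N -> (t <= d)%N -> (0 < d)%N -> (0 < H)%N ->
  (forall i, `|c i| <= C)%N -> (`|u| <= H)%N -> (`|x| <= H)%N ->
  (`|(linear_change (t%:Z : int) 0 0 (monomial_sum c))^`().[u, (x - t%:Z * u)]|
     <= #|I| * (C * (2 * d ^ 2 * H ^ d)))%N.
Proof.
move=> ed td d0 H0 cC uH xH; rewrite shear_deriv_horner -sum_nat_const.
apply: absz_sum_leq => i; rewrite -[_ *+ e1 i]mulr_natl -[_ *+ e2 i]mulr_natl.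
rewrite abszM leq_mul //.
have absD (y z : int) : (absz (y + z)%R <= `|y| + `|z|)%N.
  by rewrite -lez_nat PoszD !abszE ler_normD.
have powH (y : int) k m : (`|y| <= H)%N -> (k <= m)%N -> (`|y| ^ k <= H ^ k)%N.
  by move=> yH _; case: k => // k; rewrite leq_exp2r.
apply: leq_trans (absD _ _) _; rewrite !abszM !abszX !natz !absz_nat.
have edi := ed i.
have powd k l : (k + l <= d)%N -> (`|x| ^ k * `|u| ^ l <= H ^ d)%N.
  move=> kl; apply: (@leq_trans (H ^ k * H ^ l)).
    by apply: leq_mul; [apply: (powH _ _ k) | apply: (powH _ _ l)].
  by rewrite -expnD leq_pexp2l.
rewrite -!mulnA mul2n -addnn; apply: leq_add.
  have := powd (e1 i).-1 (e2 i); case: (e1 i) edi => [|k] edi h.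
    by rewrite mul0n.
  by rewrite leq_mul //; [lia | rewrite leq_mul //; apply: h => /=; lia].
have := powd (e1 i) (e2 i).-1; case: (e2 i) edi => [|k] edi h.
  by rewrite mul0n.
rewrite leq_mul //; first by lia.
by rewrite -[leqLHS]mul1n leq_mul //; apply: h => /=; lia.
Qed.

End MonomialSum.

(** * Counting points with a given range of auxiliary primes *)

(** The representative in [0, p - 1] of x - K, which is at most H on the interval. *)
Definition lift_Fp p (K : int) (x : 'F_p) : nat := val (x - K%:~R).

Lemma lift_FpK p (K : int) (x : 'F_p) : (lift_Fp K x)%:R = x - K%:~R.
Proof. exact: natr_Zp. Qed.

Lemma lift_Fp_interval p (K : int) H (x : 'F_p) : prime p -> (H < p)%N ->
  x \in Fp_interval p K H -> (lift_Fp K x <= H)%N.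
Proof.
move=> pp Hp /imsetP[i _ ->]; rewrite /lift_Fp.
have -> : (K + i%:Z)%:~R - K%:~R = i%:R :> 'F_p by rewrite intrD addrAC subrr add0r.
have iH : (i <= H)%N by rewrite -ltnS.
by rewrite [val _](val_Fp_nat pp i) modn_small // (leq_ltn_trans iH).
Qed.

Section PointCount.

Variables (d D p H n : nat) (F : {poly {poly 'F_p}}) (K L : int) (a : nat -> nat).

Let Dl := divisor_exponents F.
Let C := ((delta F)`! * (H ^ d) ^ delta F)%N.
Let S := [set ab in setX (Fp_interval p K H) (Fp_interval p L H) | F.[ab.1, ab.2] == 0].

Hypotheses (d2 : (2 <= d)%N) (pp : prime p) (Firr : absolutely_irreducible F)
  (dF : total_degree F = d) (dp : (d < p)%N) (Hp : (H < p)%N) (H0 : (0 < H)%N)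
  (Hsmall : ((delta F)`! * H ^ (\sum_(kl in Dl) (kl.1 + kl.2)) < p)%N).

Let X (ab : 'F_p * 'F_p) := lift_Fp K ab.1.
Let Y (ab : 'F_p * 'F_p) := lift_Fp L ab.2.

Lemma points_lift ab : ab \in S -> (X ab <= H)%N /\ (Y ab <= H)%N.
Proof.
by rewrite !inE => /andP[/andP[h1 h2] _]; split; apply: lift_Fp_interval.
Qed.

Let e1 (i : 'I_(delta F)) : nat := (enum_val (A := Dl) i).1.
Let e2 (i : 'I_(delta F)) : nat := (enum_val (A := Dl) i).2.

(** The translated polynomial F is a relation modulo p between the rows of monomial
    values; small_kernel replaces it by a relation over the integers. *)
Lemma integral_model : exists c : 'I_(delta F) -> int,
  [/\ forall ab, ab \in S -> \sum_i c i * ((X ab)%:Z ^+ e1 i * (Y ab)%:Z ^+ e2 i) = 0,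
      exists i, (c i)%:~R != 0 :> 'F_p & forall i, (`|c i| <= C)%N].
Proof.
have F0 : F != 0.
  by have [h _ _] := Firr; apply: contraNneq h => ->; rewrite !map_poly0.
set F1 := linear_change 0 (K%:~R : 'F_p) (L%:~R : 'F_p) F.
pose f := \row_(i < delta F) F1`_(e2 i)`_(e1 i).
pose M := \matrix_(i < delta F, j < #|S|)
  ((X (enum_val j))%:Z ^+ e1 i * (Y (enum_val j))%:Z ^+ e2 i).
have ptF ab : F.[ab.1, ab.2] =
    \sum_(i < delta F) F1`_(e2 i)`_(e1 i) * ((X ab)%:R ^+ e1 i * (Y ab)%:R ^+ e2 i).
  have -> : ab.1 = (X ab)%:R + K%:~R by rewrite lift_FpK subrK.
  have -> : F.[(X ab)%:R + K%:~R, ab.2] = F.[(X ab)%:R + K%:~R, (Y ab)%:R + L%:~R].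
    by rewrite [(Y ab)%:R]lift_FpK subrK.
  rewrite translated_horner big_enum_val /=; apply: eq_bigr => i _ //.
have [||i j|i||c [cM cnz cb]] :=
  @small_kernel p _ _ M (fun i => H ^ (e1 i + e2 i))%N (H ^ d)%N f pp.
- have F10 : F1 != 0.
    exact: linear_change_neq0.
  have nz : F1`_(size F1).-1`_(size (lead_coef F1)).-1 != 0.
    by rewrite -lead_coefE -lead_coefE !lead_coef_eq0.
  have [kl klD [E1 E2]] := linear_change0_support nz.
  apply: contraNneq nz => /rowP/(_ (enum_rank_in klD kl)).
  by rewrite !mxE /e1 /e2 enum_rankK_in // E1 E2 => ->.
- apply/rowP=> j; rewrite !mxE.
  have : F.[(enum_val j).1, (enum_val j).2] = 0.
    by have := enum_valP j; rewrite inE => /andP[_ /eqP].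
  rewrite ptF => E0; rewrite -[RHS]E0; apply: eq_bigr => i _.
  by rewrite !mxE rmorphM !rmorphXn.
- have [xH yH] := points_lift (enum_valP j).
  rewrite mxE abszM !abszX !absz_nat expnD.
  by apply: leq_mul; [case: (e1 i) | case: (e2 i)] => // k; rewrite leq_exp2r.
- rewrite expn_gt0 H0 /= leq_pexp2l //.
  by rewrite -dF divisor_exponent_degree // enum_valP.
- by rewrite -expn_sum; move: Hsmall; rewrite big_enum_val.
exists (c ord0); split => //.
move=> ab abS; have /rowP/(_ (enum_rank_in abS ab)) := cM; rewrite !mxE => E0.
by rewrite -[RHS]E0; apply: eq_bigr => i _; rewrite !mxE enum_rankK_in.
Qed.

Hypotheses (n0 : (0 < n)%N)
  (En : ((delta F * (C * (2 * d ^ 2 * H ^ d))) ^ trunc_log 2 n.*2 < 2 ^ n)%N)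
  (ha : forall q, prime q -> (q <= n.*2)%N -> (0 < a q)%N /\
     ((d * D)`! * (d.+1 * H) ^ (D * 'C(d, 2) + d * 'C(D, 2)) < q ^ (a q * 'C(d * D, 2)))%N).

(** Either the integral model is independent of F modulo p and Bezout's bound
    suffices, or it lifts a multiple of F.  In that case the points where the
    derivative vanishes modulo p are bounded by Bezout, and every other point is
    counted at some prime q <= 2n that does not divide the derivative there. *)
Lemma point_count_leq : (#|S| <= 2 * d * d * d +
   \sum_(q < n.*2.+1 | prime q) q ^ (a q).+1 * (2 * d * (d + D) * d))%N.
Proof.
have F0 : F != 0.
  by have [h _ _] := Firr; apply: contraNneq h => ->; rewrite !map_poly0.
have tdF := @total_degree_tdeg _ F; rewrite dF in tdF.
have [t td lc0] := good_shear pp dp F0 dF.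
set lc := \sum_(i < d.+1) _ in lc0.
set Fs := linear_change (t%:R : 'F_p) K%:~R L%:~R F.
have tdFs : tdeg_le d Fs by apply: linear_change_tdeg.
have lcFs : Fs`_d = lc%:P by rewrite (tdeg_le_lead tdFs) (linear_change_top _ _ _ tdF).
have szFs : size Fs = d.+1.
  apply/eqP; rewrite eqn_leq tdeg_le_size //= ltnNge; apply: contraNN lc0 => h.
  by rewrite -polyC_eq0 -lcFs nth_default.
have irrFs : absolutely_irreducible Fs by apply: linear_change_irreducible.
pose U ab : int := (Y ab)%:Z.
pose V ab : int := (X ab)%:Z - t%:Z * (Y ab)%:Z.
have UE ab : (U ab)%:~R = ab.2 - L%:~R :> 'F_p by apply: lift_FpK.
have VE ab : (V ab)%:~R = ab.1 - K%:~R - t%:R * (ab.2 - L%:~R) :> 'F_p.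
  by rewrite /V rmorphB rmorphM /= -UE; congr (_ - _); apply: lift_FpK.
have FsE ab : Fs.[(U ab)%:~R, (V ab)%:~R] = F.[ab.1, ab.2].
  rewrite linear_change_horner UE VE.
  have -> : ab.1 - K%:~R - t%:R * (ab.2 - L%:~R) + K%:~R + t%:R * (ab.2 - L%:~R)
      = ab.1 :> 'F_p by ring.
  by rewrite subrK.
have FS ab : ab \in S -> Fs.[(U ab)%:~R, (V ab)%:~R] = 0.
  by rewrite FsE inE => /andP[_ /eqP].
have inj (A : {set 'F_p * 'F_p}) : {in A &, injective (residue_point p U V)}.
  move=> [x y] [x' y'] _ _ [] hU hV; move: hU hV; rewrite !UE !VE /= => /addIr yy.
  by rewrite yy => /addIr/addIr->.
have [c [cS [i0 ci0] cC]] := integral_model.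
pose G := linear_change (t%:Z) 0 0 (monomial_sum e1 e2 c).
have tdG : tdeg_le d G.
  apply: linear_change_tdeg; apply: monomial_sum_tdeg => i.
  by rewrite -dF divisor_exponent_degree // enum_valP.
have Ge (u v : int) : G.[u, v] = \sum_i c i * ((v + t%:Z * u) ^+ e1 i * u ^+ e2 i).
  by rewrite linear_change_horner !addr0 monomial_sum_horner.
have GS ab : ab \in S -> G.[U ab, V ab] = 0.
  by move=> abS; rewrite Ge /V subrK cS.
pose Gp := map_poly (map_poly intr) G : {poly {poly 'F_p}}.
have Gp0 : Gp != 0.
  rewrite /Gp linear_change_map monomial_sum_map; apply: linear_change_neq0.
  apply: (monomial_sum_neq0 (i := i0)) ci0 => i j [h1 h2]; apply: enum_val_inj.
  move: h1 h2; rewrite /e1 /e2.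
  by case: (enum_val i) => [k l]; case: (enum_val j) => [k' l'] /= /val_inj -> /val_inj ->.
have tdGp : tdeg_le d Gp.
  by move=> i j h; rewrite coef_map coef_map tdG ?rmorph0.
have Gpe (u v : int) (P : {poly {poly int}}) :
    (map_poly (map_poly intr) P).[u%:~R, v%:~R] = (P.[u, v])%:~R :> 'F_p.
  exact: horner2_map.
have [g gE] : exists g, Gp`_d = g%:P by exists (Gp`_d`_0); apply: tdeg_le_lead.
pose P := lc%:P *: Gp - g%:P *: Fs.
have GpS ab : ab \in S -> Gp.[(U ab)%:~R, (V ab)%:~R] = 0.
  by move=> abS; rewrite Gpe GS.
have szYFs : (sizeY Fs <= d.+1)%N by apply: tdeg_le_sizeY.
have tdP : tdeg_le d P.
  by move=> i j h; rewrite !(coefB, coefZ, coefCM) tdGp // tdFs // !mulr0 subrr.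
have szP : (size P <= d)%N.
  apply/leq_sizeP => j; rewrite leq_eqVlt => /orP[/eqP<-|dj].
    by rewrite coefB !coefZ lcFs gE mulrC subrr.
  by apply/polyP=> i; rewrite coef0 tdP // ltn_addr.
(* P has no u^d term, so it vanishes exactly when G and Fs are proportional. *)
have [P0|P0] := eqVneq P 0; last first.
  apply: leq_trans (leq_addr _ _).
  apply: (@common_points_leq p _ (to_alg_closure 'F_p) Fs d lc _ U V
    irrFs szFs lcFs szYFs d P) => //.
  - exact: tdeg_le_sizeY.
  - move=> ab abS; rewrite /P hornerD hornerN !hornerZ hornerD hornerN !hornerM.
    by rewrite GpS // FS // !mulr0 subrr.
have g0 : g != 0.
  apply: contraNneq Gp0 => z; move/eqP: P0; rewrite /P z scale0r subr0.
  by rewrite scale_poly_eq0 polyC_eq0 (negPf lc0).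
have tdFs' : tdeg_le d Fs^`().
  by move=> i j h; rewrite coef_deriv coefMn tdFs ?mul0rn // addSn ltnS ltnW.
have Fs'0 : Fs^`() != 0.
  apply/eqP => /(congr1 (fun Q : {poly {poly 'F_p}} => Q`_d.-1)).
  have d0 : (0 < d)%N by apply: leq_trans d2.
  rewrite coef_deriv coef0 prednK // lcFs => /eqP.
  rewrite -mulr_natr -[d%:R]polyC_natr -polyCM polyC_eq0 mulf_eq0 (negPf lc0) /=.
  by rewrite -(dvdn_pcharf (pchar_Fp pp)) gtnNdvd.
pose S1 := [set ab in S | Fs^`().[(U ab)%:~R, (V ab)%:~R] == 0].
have S1S ab : ab \in S1 -> ab \in S by rewrite inE => /andP[].
rewrite -(cardsID S1 S); apply: leq_add.
  have -> : S :&: S1 = S1 by apply/setIidPr/subsetP.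
  apply: (@common_points_leq p _ (to_alg_closure 'F_p) Fs d lc _ U V
    irrFs szFs lcFs szYFs d Fs^`()) => //.
  - by rewrite -ltnS -szFs lt_size_deriv // -size_poly_eq0 szFs.
  - exact: tdeg_le_sizeY.
  - by move=> ab /S1S; apply: FS.
  - by move=> ab; rewrite inE => /andP[_ /eqP].
pose A ab := (G^`()).[U ab, V ab].
have A0 ab : ab \in S :\: S1 -> (0 < `|A ab|)%N.
  rewrite !inE => /andP[nz abS]; rewrite absz_gt0; apply: contraNneq nz => Az; rewrite abS /=.
  have : (lc%:P *: Gp)^`() = (g%:P *: Fs)^`().
    by congr deriv; apply/eqP; rewrite -subr_eq0; apply/eqP.
  rewrite !derivZ => /(congr1 (fun Q : {poly {poly 'F_p}} => Q.[(U ab)%:~R, (V ab)%:~R])).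
  rewrite !hornerZ !hornerM !hornerC /Gp deriv_map Gpe -/(A ab) Az mulr0 => /esym/eqP.
  by rewrite mulf_eq0 (negPf g0).
have AE ab : ab \in S :\: S1 -> (`|A ab| <= delta F * (C * (2 * d ^ 2 * H ^ d)))%N.
  move=> /setDP[abS _]; have [xH yH] := points_lift abS.
  rewrite -{1}[delta F]card_ord; apply: shear_deriv_bound => //.
  - by move=> i; rewrite -dF divisor_exponent_degree // enum_valP.
  - exact: leq_trans d2.
have hE m : (m <= delta F * (C * (2 * d ^ 2 * H ^ d)))%N -> (m ^ trunc_log 2 n.*2 < 2 ^ n)%N.
  move=> mE; apply: leq_ltn_trans En; case: (trunc_log 2 n.*2) => // k.
  by rewrite leq_exp2r.
have cover ab : ab \in S :\: S1 -> exists2 q : 'I_n.*2.+1, prime q & ~~ (q %| A ab)%Z.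
  move=> abS2; have [q [qp qn qA]] :=
    @exists_prime_not_dvd n `|A ab| n0 (A0 _ abS2) (hE _ (AE _ abS2)).
  by exists (Ordinal (qn : (q < n.*2.+1)%N)); rewrite // dvdzE.
apply: leq_trans (card_leq_sum_cover cover) _; apply: leq_sum => q qp.
have qn : (q <= n.*2)%N by rewrite -ltnS.
have [a0 small] := ha qp qn.
have S2S ab : ab \in [set t0 in S :\: S1 | ~~ (q %| A t0)%Z] -> ab \in S.
  by rewrite !inE -andbA => /and3P[].
apply: (@residue_classes_leq p _ (to_alg_closure 'F_p) Fs d D lc _ U V
  irrFs szFs lcFs szYFs G (d.+1 * H) q (a q)) => //.
- by move=> ab /S2S; apply: FS.
- by move=> ab /S2S; apply: GS.
- move=> ab /S2S/points_lift[xH yH]; rewrite /U /V absz_nat.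
  rewrite (leq_trans yH) ?leq_pmull //= -lez_nat abszE.
  apply: le_trans (ler_normB _ _) _; rewrite normrM -!abszE !absz_nat.
  by rewrite -PoszM -PoszD lez_nat mulSn leq_add // leq_mul.
- by move=> ab; rewrite inE => /andP[].
Qed.

End PointCount.

(** * Choice of the auxiliary primes and exponents *)

Lemma zero_count_trivial p (F : {poly {poly 'F_p}}) H K L :
  (zero_count F (Fp_interval p K H) (Fp_interval p L H) <= H.+1 ^ 2)%N.
Proof.
apply: leq_trans (_ : #|setX (Fp_interval p K H) (Fp_interval p L H)| <= _)%N.
  by apply: subset_leq_card; apply/subsetP => ab; rewrite inE => /andP[].
have hI M : (#|Fp_interval p M H| <= H.+1)%N.
  by apply: leq_trans (leq_imset_card _ _) _; rewrite card_ord.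
by rewrite cardsX expnS expn1 leq_mul.
Qed.

(** The range of H in terms of p, squared to clear the halves, gives the three size
    conditions of the lifting once H exceeds a constant depending only on d. *)
Lemma large_prime_consequences d p (F : {poly {poly 'F_p}}) H (m := (d.+1 ^ 2)%N) :
  F != 0 -> total_degree F = d -> (2 <= d)%N -> (m`! ^ 2 * (m * (2 * d ^ 2)) < H)%N ->
  (H ^ ((2 * d - 1) * delta F + 1) <= p ^ 2)%N ->
  [/\ (H < p)%N, ((delta F)`! * H ^ (\sum_(kl in divisor_exponents F) (kl.1 + kl.2)) < p)%N &
    (delta F * (((delta F)`! * (H ^ d) ^ delta F) * (2 * d ^ 2 * H ^ d)) < H ^ (d * m + d).+1)%N].
Proof.
move=> F0 dF d2 HH Hp.
have d2' : (0 < d)%N by apply: leq_trans d2.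
have dm : (delta F <= m)%N by rewrite /m -dF delta_leq.
have deg := sum_divisor_degrees F0 dF d2.
set Sg := (\sum_(kl in _) _)%N in deg *.
have H0 : (0 < H)%N by apply: leq_ltn_trans HH.
have m0 : (0 < m)%N by rewrite /m expn_gt0.
have md0 : (0 < m * (2 * d ^ 2))%N by rewrite muln_gt0 m0 /= muln_gt0 /= expn_gt0 d2'.
have H1 : (1 < H)%N.
  by apply: leq_ltn_trans HH; rewrite muln_gt0 expn_gt0 fact_gt0.
have fm : ((delta F)`! <= m`!)%N by apply: leq_fact.
have fH : ((delta F)`! ^ 2 < H)%N.
  apply: leq_ltn_trans HH; rewrite -[leqLHS]muln1; apply: leq_mul.
    by rewrite leq_exp2r.
  exact: md0.
have Hp3 : (H ^ (2 * Sg + 3) <= p ^ 2)%N.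
  apply: leq_trans Hp; rewrite leq_pexp2l // mulnBl mul1n.
  by move: deg; move: (2 * d * delta F)%N (delta F) Sg => x y w; clear; lia.
split.
- rewrite -(@ltn_exp2r _ _ 2) //; apply: leq_trans Hp3.
  by rewrite ltn_exp2l //; lia.
- rewrite -(@ltn_exp2r _ _ 2) // expnMn -expnM; apply: leq_trans Hp3.
  apply: (@leq_trans (H * H ^ (Sg * 2))); first by rewrite ltn_mul2r expn_gt0 H0 fH.
  by rewrite -expnS leq_exp2l //; lia.
apply: (@leq_ltn_trans (m`! ^ 2 * (m * (2 * d ^ 2)) * H ^ (d * m + d))).
  rewrite -!expnM expnD.
  apply: (@leq_trans (m * ((m`! * H ^ (d * m)) * (2 * d ^ 2 * H ^ d)))).
    apply: leq_mul => //; apply: leq_mul => //; apply: leq_mul => //.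
    by rewrite leq_pexp2l // leq_mul2l dm orbT.
  have f1 : (m`! <= m`! ^ 2)%N by rewrite expnS expn1 leq_pmulr // fact_gt0.
  apply: (@leq_trans (m`! * (m * (2 * d ^ 2)) * (H ^ (d * m) * H ^ d))).
    by apply: eq_leq; ring.
  by rewrite leq_mul2r leq_mul2r f1 !orbT.
by rewrite (expnS H) ltn_mul2r expn_gt0 H0.
Qed.

(** By exists_prime_not_dvd, a positive integer below 2^(e l) thus has a prime
    nondivisor of size at most 16 (e l)^2; with l about log H this is negligible
    against any power of H. *)
Lemma prime_range e l : (0 < e)%N -> (0 < l)%N -> forall E, (E < 2 ^ (e * l))%N ->
  (E ^ trunc_log 2 (8 * (e * l) ^ 2).*2 < 2 ^ (8 * (e * l) ^ 2))%N.
Proof.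
move=> e0 l0 E; set u := (e * l)%N => EU.
have u0 : (0 < u)%N by rewrite muln_gt0 e0.
set T := trunc_log _ _.
have T1 : (T < 2 * u + 4)%N.
  rewrite -(@ltn_exp2l 2) //; apply: (@leq_ltn_trans (8 * u ^ 2).*2).
    by apply: trunc_logP; rewrite // double_gt0 muln_gt0 expn_gt0 u0.
  have : (u ^ 2 < (2 ^ u) ^ 2)%N by rewrite ltn_exp2r // ltn_expl.
  by rewrite expnD [(2 * u)%N]mulnC expnM -mul2n; lia.
apply: (@leq_ltn_trans ((2 ^ u) ^ T)).
  by case: (T) => // k; rewrite leq_exp2r // ltnW.
by rewrite -expnM ltn_exp2l //; nia.
Qed.

Lemma least_exponent q N c : (1 < q)%N -> (0 < N)%N -> (0 < c)%N ->
  exists a, [/\ (0 < a)%N, (N < q ^ (a * c))%N & ((q ^ a.-1) ^ c <= N)%N].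
Proof.
move=> q1 N0 c0.
have ex : exists a, (N < q ^ (a * c))%N.
  exists N; apply: (@leq_trans (q ^ N)); first exact: ltn_expl.
  by rewrite leq_exp2l // leq_pmulr.
case: (ex_minnP ex) => a ha amin; exists a.
have a0 : (0 < a)%N by case: a ha {amin} => //; rewrite mul0n expn0 ltnNge N0.
split=> //; rewrite -expnM leqNgt; apply/negP => /amin.
by case: a a0 {ha amin} => // a _; rewrite ltnn.
Qed.

(** W is the largest of the q^(a - 1), where a is the least exponent for which the
    determinants at the prime q vanish; its minimality bounds W by about
    H^(1/d + O(1/D)). *)
Lemma count_bound d D p (F : {poly {poly 'F_p}}) H K L
   (m := (d.+1 ^ 2)%N) (z := (16 * (((d * m + d).+1) * (trunc_log 2 H).+1) ^ 2)%N) :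
  prime p -> absolutely_irreducible F -> total_degree F = d -> (2 <= d)%N -> (0 < D)%N ->
  (m`! ^ 2 * (m * (2 * d ^ 2)) < H)%N ->
  (H ^ ((2 * d - 1) * delta F + 1) <= p ^ 2)%N ->
  exists W, (W ^ 'C(d * D, 2) <= (d * D)`! * (d.+1 * H) ^ (D * 'C(d, 2) + d * 'C(D, 2)))%N /\
   (zero_count F (Fp_interval p K H) (Fp_interval p L H) <=
     2 * d * d * d + z.+1 * (z ^ 2 * W * (2 * d * (d + D) * d)))%N.
Proof.
move=> pp Firr dF d2 D0 HH Hp.
have F0 : F != 0.
  by have [h _ _] := Firr; apply: contraNneq h => ->; rewrite !map_poly0.
have [HP small EH] := large_prime_consequences F0 dF d2 HH Hp.
have H0 : (0 < H)%N by apply: leq_ltn_trans HH.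
have dH : (d < H)%N.
  apply: leq_ltn_trans HH; rewrite -[leqLHS]mul1n leq_mul ?expn_gt0 ?fact_gt0 //.
  have d0 : (0 < d)%N by apply: leq_trans d2.
  rewrite -[leqLHS]mul1n; apply: leq_mul; first by rewrite expn_gt0.
  by rewrite expnS expn1 mulnA leq_pmull // muln_gt0.
set N0 := ((d * D)`! * _)%N; set e2 := 'C(d * D, 2).
have e20 : (0 < e2)%N by rewrite bin_gt0 (leq_trans d2) // leq_pmulr.
have N00 : (0 < N0)%N by rewrite muln_gt0 fact_gt0 expn_gt0 muln_gt0 H0.
have exa q : exists a, prime q ==> [&& 0 < a, N0 < q ^ (a * e2) & (q ^ a.-1) ^ e2 <= N0]%N.
  have [qp|_] := boolP (prime q); last by exists 0%N.
  by have [a [h1 h2 h3]] := least_exponent (prime_gt1 qp) N00 e20; exists a; apply/and3P.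
pose a q := xchoose (exa q).
have aP q : prime q -> [/\ 0 < a q, N0 < q ^ (a q * e2) & (q ^ (a q).-1) ^ e2 <= N0]%N.
  by move=> qp; have /implyP/(_ qp)/and3P := xchooseP (exa q).
set e := (d * m + d).+1 in z EH *; set l := (trunc_log 2 H).+1 in z *.
have zE : z = (8 * (e * l) ^ 2).*2 by rewrite -mul2n mulnA.
have Hl : (H ^ e < 2 ^ (e * l))%N.
  by rewrite mulnC expnM ltn_exp2r // trunc_log_ltn.
have En := prime_range (ltn0Sn _ : 0 < e)%N (ltn0Sn _ : 0 < l)%N (ltn_trans EH Hl).
exists (\max_(q < z.+1 | prime q) q ^ (a q).-1)%N; split.
  apply: (big_ind (fun x => x ^ e2 <= N0)%N) => [|x y hx hy|q qp].
  - by rewrite exp0n.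
  - by rewrite /maxn; case: ifP.
  by have [] := aP q qp.
have n0 : (0 < 8 * (e * l) ^ 2)%N by rewrite muln_gt0 expn_gt0 muln_gt0.
have Ha q : prime q -> (q <= (8 * (e * l) ^ 2).*2)%N -> (0 < a q)%N /\ (N0 < q ^ (a q * e2))%N.
  by move=> qp _; have [h1 h2 _] := aP q qp.
have pc := point_count_leq K L d2 pp Firr dF (ltn_trans dH HP) HP H0 small n0 En Ha.
apply: leq_trans pc _.
rewrite leq_add2l -zE; set W := (\max_(q < z.+1 | _) _)%N; set C2 := (2 * d * (d + D) * d)%N.
apply: (@leq_trans (\sum_(q < z.+1 | prime q) z ^ 2 * W * C2)).
  apply: leq_sum => q qp; rewrite leq_mul2r; apply/orP; right.
  have [a0 _ _] := aP q qp.
  have -> : (q ^ (a q).+1 = q ^ 2 * q ^ (a q).-1)%N by rewrite -expnD add2n prednK.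
  apply: leq_mul; first by rewrite leq_exp2r // -ltnS.
  exact: (@leq_bigmax_cond _ (fun q : 'I_z.+1 => prime q) (fun q : 'I_z.+1 => q ^ (a q).-1)%N q qp).
rewrite sum_nat_const leq_mul2r; apply/orP; right.
by apply: leq_trans (max_card _) _; rewrite card_ord.
Qed.

From mathcomp Require Import all_classical all_reals all_analysis.
Import numFieldNormedType.Exports.

(** * Real estimates *)

Lemma bin2_real (R : realType) n : ('C(n, 2)%:R : R) * 2 = n%:R * (n%:R - 1).
Proof.
elim: n => [|n IH]; first by rewrite mul0r mul0r.
by rewrite binS bin1 natrD mulrDl IH -[n.+1]addn1 natrD; ring.
Qed.

(** The quotient of the two integers tends to 1/d as D grows. *)
Lemma box_exponent (R : realType) d (eta : R) : (2 <= d)%N -> 0 < eta ->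
  exists2 D, (0 < D)%N &
    (D * 'C(d, 2) + d * 'C(D, 2))%:R <= (1 / d%:R + eta) * ('C(d * D, 2))%:R.
Proof.
move=> d2 eta0; have d0 : (0 : R) < d%:R by rewrite ltr0n; apply: leq_trans d2.
have d1 : (1 : R) <= d%:R by rewrite ler1n; apply: leq_trans d2.
pose M := Num.bound eta^-1.
have hM : eta^-1 < M%:R by apply: archi_boundP; rewrite invr_ge0 ltW.
(* D - 1 >= 1/eta is what the final inequality needs. *)
exists M.+1 => //.
have eM : 1 <= eta * M%:R by rewrite mulrC -ler_pdivrMr // div1r ltW.
rewrite -(ler_pM2r (x := 2)) // natrD !natrM mulrDl -mulrA bin2_real -mulrA bin2_real.
rewrite -[X in _ <= X]mulrA bin2_real natrM -[M.+1]addn1 natrD.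
set m := M%:R in hM eM *; set e := d%:R in d0 d1 *.
have m0 : 0 <= m by rewrite ler0n.
have -> : (1 / e + eta) * (e * (m + 1) * (e * (m + 1) - 1)) =
   (m + 1) * (e * (m + 1) - 1) * (1 + eta * e) by field; rewrite gt_eqF.
have e0 := ltW d0; have eta0' := ltW eta0.
have h1 : 0 <= (eta * m - 1) * (e * e) by apply: mulr_ge0; rewrite ?subr_ge0 // mulr_ge0.
have h2 : 0 <= eta * e * (e - 1) by apply: mulr_ge0; rewrite ?subr_ge0 // mulr_ge0.
have h3 : e * (e - 1 + m) <= (e * (m + 1) - 1) * (1 + eta * e) by lra.
have -> : (m + 1) * (e * (e - 1)) + e * ((m + 1) * (m + 1 - 1)) =
  (m + 1) * (e * (e - 1 + m)) by ring.
by rewrite -[leRHS]mulrA ler_wpM2l // addr_ge0.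
Qed.

(** By Bernoulli's inequality, log H is O(H^eta). *)
Lemma log_le_power (R : realType) (eta : R) : 0 < eta ->
  exists2 c : R, 0 < c & forall H, (0 < H)%N ->
    ((trunc_log 2 H).+1)%:R <= c * H%:R `^ eta.
Proof.
move=> eta0; pose b : R := 2 `^ eta - 1.
have b0 : 0 < b.
  have h12 : (1 : R) `^ eta < 2 `^ eta by apply: gt0_ltr_powR; rewrite ?nnegrE ?ltr1n.
  by rewrite subr_gt0; move: h12; rewrite powR1.
exists (1 + b^-1); first by rewrite addr_gt0 // invr_gt0.
move=> H H0; set l := trunc_log 2 H.
have bern : 1 + l%:R * b <= (1 + b) ^+ l.
  elim: l => [|l IH]; first by rewrite expr0 mul0r addr0.
  rewrite exprS; apply: le_trans (ler_wpM2l _ IH); last by rewrite addr_ge0 // ltW.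
  rewrite -[l.+1]addn1 natrD; have := ler0n R l; nra.
have pw : (1 + b) ^+ l <= H%:R `^ eta.
  rewrite /b addrC subrK -powR_mulrn ?powR_ge0 // -powRrM mulrC powRrM powR_mulrn //.
  apply: ge0_ler_powR; rewrite ?nnegrE ?exprn_ge0 ?ler0n //; first exact: ltW.
  by rewrite -natrX ler_nat trunc_logP.
apply: (@le_trans _ _ ((1 + b^-1) * (1 + l%:R * b))); last first.
  by rewrite ler_wpM2l ?(le_trans bern) // addr_ge0 // invr_ge0 ltW.
have -> : (1 + b^-1) * (1 + l%:R * b) = 1 + l%:R * b + b^-1 + l%:R.
  by field; rewrite gt_eqF.
rewrite -[l.+1]addn1 natrD; have : 0 <= l%:R * b by rewrite mulr_ge0 // ltW.
have : 0 < b^-1 by rewrite invr_gt0.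
by lra.
Qed.

(** Doubling the exponent makes it an integer. *)
Lemma range_hypothesis (R : realType) d p e H : (2 <= d)%N -> (0 < H)%N ->
  (H%:R : R) <= p%:R `^ (1 / ((d%:R - 1 / 2%:R) * e%:R + 1 / 2%:R)) ->
  (H ^ ((2 * d - 1) * e + 1) <= p ^ 2)%N.
Proof.
move=> d2 H0; set E := _ * _ + _ => hH.
have E2 : ((2 * d - 1) * e + 1)%:R = E * 2 :> R.
  rewrite natrD natrM natrB; last by lia.
  by rewrite natrM /E; field.
have E0 : 0 < E.
  by rewrite -(pmulr_lgt0 _ (ltr0n R 2)) -E2 ltr0n addn1.
rewrite -(ler_nat R) !natrX -powR_mulrn // E2.
apply: (@le_trans _ _ ((p%:R `^ (1 / E)) `^ (E * 2))).
  by apply: ge0_ler_powR; rewrite ?nnegrE ?powR_ge0 // mulr_ge0 // ltW.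
by rewrite -powRrM mulrA div1r mulVf ?gt_eqF // mul1r powR_mulrn.
Qed.

(** * The uniform bound *)

(** Half of eps is spent on the choice of D, the other half on the number and the
    size of the auxiliary primes.  Small H are absorbed in the constant. *)
Lemma uniform_bound (R : realType) d (eps : R) : (2 <= d)%N -> 0 < eps ->
  exists2 C : R, 1 <= C &
    forall (p : nat) (F : {poly {poly 'F_p}}),
      prime p -> absolutely_irreducible F -> total_degree F = d ->
    forall H : nat, (1 < H)%N ->
      (H%:R : R) <=
        p%:R `^ (1 / ((d%:R - 1 / 2%:R) * (delta F)%:R + 1 / 2%:R)) ->
    forall K L : int,
      ((zero_count F (Fp_interval p K H) (Fp_interval p L H))%:R : R) <=
        C * H%:R `^ (1 / d%:R + eps).
Proof.
move=> d2 eps0.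
have [D D0 hD] := box_exponent d2 (divr_gt0 eps0 (ltr0n R 2)).
have [c c0 hc] := log_le_power (divr_gt0 eps0 (ltr0n R 12)).
pose m := (d.+1 ^ 2)%N; pose e := (d * m + d).+1.
pose H0 := (m`! ^ 2 * (m * (2 * d ^ 2)))%N.
pose T2 := (D * 'C(d, 2) + d * 'C(D, 2))%N; pose e2 := 'C(d * D, 2).
pose c1 : R := ((d * D)`! * d.+1 ^ T2)%:R.
pose C2 : R := (2 * d * (d + D) * d)%:R.
pose C3 : R := (2 * d * d * d)%:R.
pose cz : R := 16 * (e%:R * c) ^+ 2.
pose C : R := (H0.+1 ^ 2)%:R + C3 + 2 * cz ^+ 3 * c1 * C2.
have cz0 : 0 <= cz by rewrite mulr_ge0 // sqr_ge0.
have C20 : 0 <= C2 by rewrite ler0n.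
have C30 : 0 <= C3 by rewrite ler0n.
have c11 : 1 <= c1 by rewrite ler1n muln_gt0 fact_gt0 expn_gt0.
have c10 : 0 <= c1 by apply: le_trans c11.
have e20 : (0 < e2)%N by rewrite bin_gt0 (leq_trans d2) // leq_pmulr.
have cz30 : 0 <= 2 * cz ^+ 3 by rewrite mulr_ge0 // exprn_ge0.
have cC0 : 0 <= 2 * cz ^+ 3 * c1 * C2 by apply: mulr_ge0 => //; apply: mulr_ge0.
exists C.
  rewrite /C -addrA -[leLHS]addr0; apply: lerD; last exact: addr_ge0.
  by rewrite ler1n expn_gt0.
move=> p F pp Firr dF H H1 hH K L.
have Hpos : (0 < H)%N by apply: leq_trans H1.
have HR1 : (1 : R) <= H%:R by rewrite ler1n.
have HR0 : (0 : R) < H%:R by rewrite ltr0n.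
set x := 1 / d%:R in hD *.
have x0 : 0 <= x by rewrite divr_ge0 // ler0n.
have Hx1 : 1 <= H%:R `^ (x + eps).
  have := ler_powR HR1 (addr_ge0 x0 (ltW eps0)); by rewrite powRr0.
have [small|large] := leqP H H0.
  apply: (@le_trans _ _ (H0.+1 ^ 2)%:R).
    rewrite ler_nat; apply: leq_trans (zero_count_trivial _ _ _ _) _.
    by rewrite leq_exp2r.
  rewrite -[leLHS]mulr1; apply: ler_pM => //.
  by rewrite /C -addrA lerDl addr_ge0.
have hp := range_hypothesis d2 Hpos hH.
have [W [hW hcount]] := count_bound K L pp Firr dF d2 D0 large hp.
rewrite -/T2 -/e2 in hW; set z := (16 * _ ^ 2)%N in hcount.
have WR : W%:R <= c1 * H%:R `^ (x + eps / 2).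
  rewrite -(@ler_pXn2r _ e2) // ?nnegrE ?mulr_ge0 ?powR_ge0 //.
  rewrite exprMn -[(H%:R `^ _) ^+ e2]powR_mulrn ?powR_ge0 // -powRrM.
  apply: (@le_trans _ _ (c1 * H%:R ^+ T2)).
    rewrite -natrX /c1 -natrX -natrM ler_nat -mulnA -expnMn; exact: hW.
  apply: ler_pM; rewrite ?exprn_ge0 //.
    by rewrite -{1}[c1]expr1 ler_weXn2l.
  by rewrite -powR_mulrn // ler_powR.
have zR : z%:R <= cz * H%:R `^ (eps / 6).
  rewrite /z natrM natrX natrM -/e /cz -mulrA ler_wpM2l //.
  have -> : H%:R `^ (eps / 6) = (H%:R `^ (eps / 12)) ^+ 2.
    by rewrite -powR_mulrn ?powR_ge0 // -powRrM; congr (_ `^ _); field.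
  rewrite -exprMn ler_pXn2r ?nnegrE ?mulr_ge0 ?powR_ge0 ?(ltW c0) //.
  by rewrite -mulrA ler_wpM2l // hc.
have z1 : (1 <= z)%N by rewrite /z muln_gt0 /= expn_gt0 muln_gt0.
clearbody z.
have zzR : (z.+1 * z ^ 2)%:R <= 2 * cz ^+ 3 * H%:R `^ (eps / 2).
  apply: (@le_trans _ _ (2 * z%:R ^+ 3)).
    rewrite -natrX -(natrM R 2) ler_nat (expnS z 2) mulnA leq_mul2r; apply/orP; right.
    by rewrite mul2n -addnn -addn1 leq_add2l.
  have -> : H%:R `^ (eps / 2) = (H%:R `^ (eps / 6)) ^+ 3.
    by rewrite -powR_mulrn ?powR_ge0 // -powRrM; congr (_ `^ _); field.
  rewrite -mulrA -exprMn; apply: ler_wpM2l => //.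
  by apply: lerXn2r; rewrite ?nnegrE ?ler0n //; apply: mulr_ge0 => //; apply: powR_ge0.
apply: (@le_trans _ _ (C3 + (z.+1 * z ^ 2)%:R * W%:R * C2)).
  rewrite /C2 /C3 -!natrM -natrD ler_nat; apply: leq_trans hcount _.
  by rewrite leq_add2l !mulnA.
apply: (@le_trans _ _ (C3 * H%:R `^ (x + eps) + (2 * cz ^+ 3 * c1 * C2) * H%:R `^ (x + eps))).
  apply: lerD; first by rewrite -{1}[C3]mulr1 ler_wpM2l.
  have -> : 2 * cz ^+ 3 * c1 * C2 * H%:R `^ (x + eps) =
     (2 * cz ^+ 3 * H%:R `^ (eps / 2)) * (c1 * H%:R `^ (x + eps / 2)) * C2.
    have -> : x + eps = eps / 2 + (x + eps / 2) by field.
    rewrite (@powRD _ _ (eps / 2)); first by ring.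
    by apply/implyP => _; rewrite gt_eqF.
  by apply: ler_wpM2r => //; apply: ler_pM.
rewrite -mulrDl ler_wpM2r ?powR_ge0 // /C -addrA lerDr ler0n //.
Qed.

(** * The exponent *)

Local Open Scope classical_set_scope.

Lemma log_exponent (R : realType) (h M : R) : 1 < h -> 0 < M -> h `^ (ln M / ln h) = M.
Proof.
move=> h1 M0; have h0 : 0 < h by apply: lt_trans h1.
by rewrite /powR gt_eqF // divfK ?lnK // gt_eqF // ln_gt0.
Qed.

(** The largest count attained at each H, or 1 when there is none; the default keeps
    its logarithm nonnegative. *)
Lemma optimal_count (A : nat -> nat -> Prop) :
  (forall H k, A H k -> (k <= H.+1 ^ 2)%N) ->
  exists M : nat -> nat, forall H,
    [/\ (1 <= M H)%N, (forall k, A H k -> (k <= M H)%N) & A H (M H) \/ M H = 1%N].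
Proof.
move=> bnd.
pose P H k := `[< A H k >] || (k == 1%N).
have exP H : exists k, P H k by exists 1%N; rewrite /P eqxx orbT.
have ubP H k : P H k -> (k <= H.+1 ^ 2)%N.
  by case/orP => [/asboolP/bnd //|/eqP ->]; rewrite expn_gt0.
exists (fun H => ex_maxn (exP H) (ubP H)) => H.
case: ex_maxnP => M PM maxM; split.
- by apply: maxM; rewrite /P eqxx orbT.
- by move=> k Ak; apply: maxM; apply/orP; left; apply/asboolP.
by case/orP: PM => [/asboolP|/eqP]; [left|right].
Qed.

(** The error term is the excess of log M / log H over x; a bound with a constant C
    for every eps makes it tend to 0, since log C / log H does. *)
Lemma exponent_of_bounds (R : realType) (x : R) (M : nat -> nat) : 0 <= x ->
  (forall H, (1 <= M H)%N) ->
  (forall eps : R, 0 < eps -> exists2 C : R, 1 <= C &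
     forall H, (1 < H)%N -> (M H)%:R <= C * H%:R `^ (x + eps)) ->
  exists o : nat -> R, o @ \oo --> (0 : R) /\
    forall H, (1 < H)%N -> (M H)%:R <= H%:R `^ (x + o H).
Proof.
move=> x0 M1 hM.
pose o H : R := Order.max 0 (ln (M H)%:R / ln H%:R - x).
exists o; split; last first.
  move=> H H1; have HR1 : (1 : R) < H%:R by rewrite ltr1n.
  have M0 : (0 : R) < (M H)%:R by rewrite ltr0n.
  rewrite -{1}(log_exponent HR1 M0); apply: ler_powR; first exact: ltW.
  by rewrite addrC -lerBlDr /o le_max lexx orbT.
apply/cvgrPdist_lt => e e0.
have [C C1 hC] := hM _ (divr_gt0 e0 (ltr0n R 2)).
pose N := Num.bound (expR (2 * ln C / e)).
have hN : expR (2 * ln C / e) < N%:R by apply: archi_boundP; apply: expR_ge0.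
have lnC0 : 0 <= ln C by apply: ln_ge0.
exists (maxn N 2) => // H /=; rewrite geq_max => /andP[NH H1].
have HR1 : (1 : R) < H%:R by rewrite ltr1n.
have HR0 : (0 : R) < H%:R by apply: lt_trans HR1.
have M0 : (0 : R) < (M H)%:R by rewrite ltr0n.
have lH0 : 0 < ln (H%:R : R) by apply: ln_gt0.
rewrite sub0r normrN ger0_norm ?le_max ?lexx // gt_max e0 /=.
have lH : 2 * ln C / e < ln H%:R.
  rewrite -ltr_expR lnK ?posrE //; apply: lt_le_trans hN _; by rewrite ler_nat.
have lM : ln (M H)%:R <= ln C + (x + e / 2) * ln H%:R.
  rewrite -ln_powR -lnM ?posrE ?powR_gt0 //; last exact: lt_le_trans C1.
  rewrite ler_ln ?posrE ?hC // mulr_gt0 ?powR_gt0 //; exact: lt_le_trans C1.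
rewrite ltrBlDr ltr_pdivrMr //; apply: le_lt_trans lM _.
have : 2 * ln C < e * ln H%:R by rewrite [ltRHS]mulrC -ltr_pdivrMr.
by lra.
Qed.

Theorem theorem1p1 (R : realType) (d : nat) (hd : (2 <= d)%N) :
  exists o : nat -> R, o @ \oo --> (0 : R) /\
    forall (p : nat) (F : {poly {poly 'F_p}}),
      prime p -> absolutely_irreducible F -> total_degree F = d ->
    forall H : nat, (1 < H)%N ->
      (H%:R : R) <=
        p%:R `^ (1 / ((d%:R - 1 / 2%:R) * (delta F)%:R + 1 / 2%:R)) ->
    forall K L : int,
      ((zero_count F (Fp_interval p K H) (Fp_interval p L H))%:R : R) <=
        H%:R `^ (1 / d%:R + o H).
Proof.
pose A H k := exists (p : nat) (F : {poly {poly 'F_p}}) (K L : int),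
  [/\ prime p, absolutely_irreducible F, total_degree F = d /\ (1 < H)%N,
      (H%:R : R) <= p%:R `^ (1 / ((d%:R - 1 / 2%:R) * (delta F)%:R + 1 / 2%:R)) &
      k = zero_count F (Fp_interval p K H) (Fp_interval p L H)].
have [M hM] : exists M : nat -> nat, forall H,
    [/\ (1 <= M H)%N, (forall k, A H k -> (k <= M H)%N) & A H (M H) \/ M H = 1%N].
  apply: optimal_count => H k [p [F [K [L [_ _ _ _ ->]]]]].
  exact: zero_count_trivial.
have [||eps eps0| f [f0 hf]] := @exponent_of_bounds R (1 / d%:R) M.
- by rewrite divr_ge0 // ler0n.
- by move=> H; have [] := hM H.
- have [C C1 hC] := uniform_bound hd eps0; exists C => // H H1.
  have [_ _ [[p [F [K [L [pp Firr [dF _] hH ->]]]]]|->]] := hM H; first exact: hC.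
  rewrite -[leLHS]mulr1; apply: ler_pM => //.
  have HR1 : (1 : R) <= H%:R by rewrite ler1n ltnW.
  have := @ler_powR _ _ HR1 0 (1 / d%:R + eps); rewrite powRr0; apply.
  by rewrite addr_ge0 ?(ltW eps0) // divr_ge0 // ler0n.
exists f; split=> // p F pp Firr dF H H1 hH K L.
apply: le_trans (hf H H1); rewrite ler_nat.
by have [_ hmax _] := hM H; apply: hmax; exists p, F, K, L.
Qed.
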